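(* Let $(M,g)$ be an oriented Riemannian 4-manifold and let $h$ be a split-signature metric on $M$ that is a deformation of $g$, with Hodge star operator $*_h$. Then $(M,g)$ is $*_h$-Einstein with respect to $h$, i.e. $\hat R_g\circ *_h=*_h\circ\hat R_g$, if and only if $$\mathrm{tr}_h(\mathrm{Rm}_g)=f\,h$$ for some smooth function $f$ on $M$, where $\mathrm{Rm}_g$ is the Riemann curvature 4-tensor of $g$. Equivalently, $(M,g)$ is $*_h$-Einstein with respect to $h$ if and only if $$\mathrm{sec}_g(P^{\perp_h})=\mathrm{sec}_g(P)$$ for all 2-planes $P$, where $P^{\perp_h}:=*_hP$.
   Context: A split-signature metric is a smooth nondegenerate metric of signature $(-,-,+,+)$. Such an $h$ is a deformation of $g$ if $g$ and $h$ have local orthonormal frames in common about every point of $M$. Write $\Lambda^2 := \Lambda^2(T_pM)$. For a metric $m$ of any signature, $\Lambda^2$ carries the inner product $\langle v_1\wedge w_1, v_2\wedge w_2\rangle_m := m(v_1,v_2)m(w_1,w_2) - m(v_1,w_2)m(w_1,v_2)$, and the Hodge star $*_m\colon\Lambda^2\to\Lambda^2$ is defined by $\xi\wedge *_m\eta = \langle\xi,\eta\rangle_m\, dV$, where $dV = e_1\wedge e_2\wedge e_3\wedge e_4$ for any oriented $m$-orthonormal basis. Curvature convention: $\mathrm{Rm}_g(a,b,c,d)=R(a,b,c,d) := g(\nabla_a\nabla_b c-\nabla_b\nabla_a c-\nabla_{[a,b]}c,d)$; the curvature operator $\hat R_g\colon\Lambda^2\to\Lambda^2$ of $g$ is defined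 by $\langle\hat R_g(v\wedge w),x\wedge y\rangle_g = -R(v,w,x,y)$. A 2-plane is identified with a $g$-unit decomposable 2-vector $P\in\Lambda^2$, and $\mathrm{sec}_g(P)=\langle\hat R_gP,P\rangle_g$. The trace is $\mathrm{tr}_h(\mathrm{Rm}_g)(x,y):=\sum_{i=1}^4 h(e_i,e_i)\,\mathrm{Rm}_g(e_i,x,y,e_i)$ for any $h$-orthonormal basis $\{e_i\}$. *)

(* Defs.v *)
From HB Require Import structures.
From mathcomp Require Import all_boot all_order all_algebra all_fingroup.
From mathcomp Require Import all_classical all_reals all_analysis.
From mathcomp Require Import ring.
Set Implicit Arguments.
Unset Strict Implicit.
Unset Printing Implicit Defensive.
Import Order.TTheory GRing.Theory Num.Theory.
Import numFieldNormedType.Exports.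
Local Open Scope classical_set_scope.
Local Open Scope ring_scope.

Section Smooth.
Variable R : realType.

(* C^infinity on an open set: every iterated directional derivative exists and
   is Frechet differentiable (hence continuous) at every point of it. *)
Definition smooth_on (U : set 'rV[R]_4) (f : 'rV[R]_4 -> R) : Prop :=
  forall (vs : seq 'rV[R]_4) (x : 'rV[R]_4), U x ->
    differentiable (foldr (fun v k => 'D_v k) f vs) x.

End Smooth.


Record chart (R : realType) (M : topologicalType) := Chart {
  cdom : set M;
  cmap : M -> 'rV[R]_4;
  cinv : 'rV[R]_4 -> M;
  cdom_open : open cdom;
  cimg_open : open (cmap @` cdom);
  cmapK : {in cdom, cancel cmap cinv};
  cmap_continuous : {within cdom, continuous cmap};
  cinv_continuous : {within cmap @` cdom, continuous cinv}
}.

Definition transition (R : realType) (M : topologicalType) (c d : chart R M)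
  : 'rV[R]_4 -> 'rV[R]_4 := cmap d \o cinv c.

Record oriented4Manifold (R : realType) := Oriented4Manifold {
  carrier :> topologicalType;
  atlas_index : Type;
  atlas : atlas_index -> chart R carrier;
  carrier_hausdorff : hausdorff_space carrier;
  carrier_second_countable : @second_countable carrier;
  atlas_cover : forall p : carrier, exists i, cdom (atlas i) p;
  transition_smooth : forall (i j : atlas_index) (k : 'I_4),
    smooth_on (cmap (atlas i) @` (cdom (atlas i) `&` cdom (atlas j)))
      (fun x => transition (atlas i) (atlas j) x ord0 k);
  transition_oriented : forall (i j : atlas_index) (p : carrier),
    cdom (atlas i) p -> cdom (atlas j) p ->
    0 < \det (jacobian (transition (atlas i) (atlas j)) (cmap (atlas i) p))
}.

Definition smooth_function (R : realType) (M : oriented4Manifold R)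
    (f : M -> R) : Prop :=
  forall i : atlas_index M,
    smooth_on (cmap (atlas i) @` cdom (atlas i)) (f \o cinv (atlas i)).

(* A smooth symmetric covariant 2-tensor field, as its Gram matrices in the
   coordinate frame of each chart.  Tangent vectors are row vectors of
   components, so that their change of coordinates is v |-> v *m 'J. *)
Record sym2Field (R : realType) (M : oriented4Manifold R) := Sym2Field {
  gram :> atlas_index M -> 'rV[R]_4 -> 'M[R]_4;
  gram_smooth : forall (i : atlas_index M) (a b : 'I_4),
    smooth_on (cmap (atlas i) @` cdom (atlas i)) (fun x => gram i x a b);
  gram_sym : forall (i : atlas_index M) (p : M), cdom (atlas i) p ->
    (gram i (cmap (atlas i) p))^T = gram i (cmap (atlas i) p);
  gram_change : forall (i j : atlas_index M) (p : M),
    cdom (atlas i) p -> cdom (atlas j) p ->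
    let J := jacobian (transition (atlas i) (atlas j)) (cmap (atlas i) p) in
    gram i (cmap (atlas i) p) = J *m gram j (cmap (atlas j) p) *m J^T
}.

Section Pointwise.
Variable R : realType.
Implicit Types (m E A B P : 'M[R]_4) (v w x y : 'rV[R]_4).

Definition inner m v w : R := (v *m m *m w^T) ord0 ord0.

(* The rows of E are the vectors of the basis. *)
Definition orthonormal m E : Prop :=
  forall a b : 'I_4,
    (a != b -> inner m (row a E) (row b E) = 0) /\
    `|inner m (row a E) (row a E)| = 1.

Definition positive_definite m : Prop := forall v, v != 0 -> 0 < inner m v v.

(* signature (-,-,+,+) *)
Definition split_form m : Prop :=
  exists2 E, E \in unitmx &
    E *m m *m E^T = diag_mx (\row_(k < 4) (if (k < 2)%N then -1 else 1)).

(* 2-vectors are skew matrices: A stands for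
   1/2 * \sum_(i, j) A i j (d_i /\ d_j), with d_i the coordinate frame. *)
Definition bivector A : Prop := A^T = - A.

Definition wedge2 v w : 'M[R]_4 := v^T *m w - w^T *m v.

Definition decomposable P : Prop := exists v w, P = wedge2 v w.

(* bilinear extension of
   <v1 /\ w1, v2 /\ w2> = m(v1,v2) m(w1,w2) - m(v1,w2) m(w1,v2) *)
Definition inner2 m A B : R :=
  2^-1 * \sum_i \sum_j \sum_k \sum_l A i j * B k l * m i k * m j l.

(* coefficient of A /\ B on d_0 /\ d_1 /\ d_2 /\ d_3 *)
Definition wedge22 A B : R :=
  4^-1 * \sum_(s : 'S_4)
    (-1) ^+ s * A (s (inord 0)) (s (inord 1)) * B (s (inord 2)) (s (inord 3)).

(* On row vectors e_0, ..., e_3 forming a matrix E, the coefficient of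
   dV = e_0 /\ e_1 /\ e_2 /\ e_3 is \det E. *)
Definition is_hodge_star m (S : 'M[R]_4 -> 'M[R]_4) : Prop :=
  [/\ linear S, forall A, bivector A -> bivector (S A) &
    forall E, orthonormal m E -> 0 < \det E ->
    forall A B, bivector A -> bivector B ->
      wedge22 A (S B) = inner2 m A B * \det E].

(* Only the values on bivectors matter, and these are determined. *)
Definition hodge_star m : 'M[R]_4 -> 'M[R]_4 :=
  xget (fun A => A) [set S | is_hodge_star m S].

Definition tensor4 := 'rV[R]_4 -> 'rV[R]_4 -> 'rV[R]_4 -> 'rV[R]_4 -> R.

Definition is_curvature_operator m (Rm : tensor4) (L : 'M[R]_4 -> 'M[R]_4)
  : Prop :=
  [/\ linear L, forall A, bivector A -> bivector (L A) &
    forall v w x y, inner2 m (L (wedge2 v w)) (wedge2 x y) = - Rm v w x y].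

Definition curvature_operator m (Rm : tensor4) : 'M[R]_4 -> 'M[R]_4 :=
  xget (fun A => A) [set L | is_curvature_operator m Rm L].

Definition plane m P : Prop := decomposable P /\ inner2 m P P = 1.

Definition sec m (Rm : tensor4) P : R :=
  inner2 m (curvature_operator m Rm P) P.

(* the common value of the sum over all m-orthonormal bases *)
Definition trace14 m (Rm : tensor4) x y : R :=
  xget 0 [set t | forall E, orthonormal m E ->
    t = \sum_(k < 4) inner m (row k E) (row k E) *
                     Rm (row k E) x y (row k E)].

Lemma wedge2_bivector v w : bivector (wedge2 v w).
Proof. by rewrite /bivector /wedge2 linearB /= !trmx_mul !trmxK opprB. Qed.

Lemma inner2_wedge2 m v w x y :
  inner2 m (wedge2 v w) (wedge2 x y) =
  inner m v x * inner m w y - inner m v y * inner m w x.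
Proof.
have innerE a b :
    inner m a b = \sum_i \sum_k a ord0 i * b ord0 k * m i k.
  rewrite /inner mxE exchange_big; apply: eq_bigr => k _.
  by rewrite !mxE mulr_suml; apply: eq_bigr => i _; rewrite mulrAC.
have innerM a b c d : inner m a c * inner m b d =
    \sum_i \sum_j \sum_k \sum_l
      a ord0 i * b ord0 j * (c ord0 k * d ord0 l) * m i k * m j l.
  rewrite !innerE big_distrl; apply: eq_bigr => i _ /=.
  rewrite mulrC big_distrl; apply: eq_bigr => j _ /=.
  rewrite mulrC big_distrl; apply: eq_bigr => k _ /=.
  by rewrite big_distrr; apply: eq_bigr => l _ /=; ring.
have -> : inner2 m (wedge2 v w) (wedge2 x y) = 2^-1 *
   (inner m v x * inner m w y - inner m v y * inner m w x
    - inner m w x * inner m v y + inner m w y * inner m v x).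
  rewrite !innerM /inner2; congr (_ * _).
  do 4! (rewrite -?sumrB -?big_split /=; apply: eq_bigr => ? _).
  by rewrite !mxE !big_ord1 !mxE; ring.
by field.
Qed.

Lemma wedge22_wedge2 E :
  wedge22 (wedge2 (row (inord 0) E) (row (inord 1) E))
          (wedge2 (row (inord 2) E) (row (inord 3) E)) = \det E.
Proof.
have detE (F : 'M[R]_4) : \det F = \sum_(s : 'S_4) (-1) ^+ s *
    (F (inord 0) (s (inord 0)) * F (inord 1) (s (inord 1)) *
     F (inord 2) (s (inord 2)) * F (inord 3) (s (inord 3))).
  apply: eq_bigr => s _; congr (_ * _).
  rewrite !big_ord_recl big_ord0 mulr1 !mulrA.
  by congr (F _ (s _) * F _ (s _) * F _ (s _) * F _ (s _));
    apply: val_inj; rewrite /= inordK.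
have neq (a b : nat) : (a < 4)%N -> (b < 4)%N -> a != b ->
    inord a != inord b :> 'I_4.
  by move=> ? ? ?; rewrite -val_eqE /= !inordK.
have det_xrow a b (F : 'M[R]_4) : a != b -> \det (xrow a b F) = - \det F.
  by move=> ab; rewrite xrowE det_mulmx det_perm odd_tperm ab expr1 mulN1r.
have n01 := neq 0 1 isT isT isT; have n23 := neq 2 3 isT isT isT.
have n02 := neq 0 2 isT isT isT; have n03 := neq 0 3 isT isT isT.
have n12 := neq 1 2 isT isT isT; have n13 := neq 1 3 isT isT isT.
have := detE; rewrite /wedge22; clear detE neq; move: n01 n23 n02 n03 n12 n13.
move: (inord 0 : 'I_4) (inord 1 : 'I_4) (inord 2 : 'I_4) (inord 3 : 'I_4).
move=> i j k l ij kl ik il jk jl detE.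
have -> : \det E = 4^-1 * (\det E - \det (xrow i j E) - \det (xrow k l E)
                           + \det (xrow i j (xrow k l E))).
  by rewrite !det_xrow//; field.
rewrite !detE; congr (_ * _).
rewrite -!sumrB -big_split /=; apply: eq_bigr => s _.
rewrite !mxE !big_ord1 !mxE !tpermL !tpermR.
rewrite (tpermD (z := k) ik jk) (tpermD (z := l) il jl) !tpermL !tpermR.
rewrite !(tpermD (x := k) (y := l) (z := i)) 1?eq_sym//.
rewrite !(tpermD (x := k) (y := l) (z := j)) 1?eq_sym//.
by move: ((-1) ^+ _ : R) => e; ring.
Qed.

End Pointwise.

Section Curvature.
Variables (R : realType) (G : 'rV[R]_4 -> 'M[R]_4).
Local Notation field := ('rV[R]_4 -> 'rV[R]_4).
Implicit Types (a b c : field) (x : 'rV[R]_4).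

Definition partial (k : 'I_4) (f : 'rV[R]_4 -> R) x : R :=
  'D_(delta_mx ord0 k) f x.

(* christoffel i j k x is Gamma_ij^k at x. *)
Definition christoffel (i j k : 'I_4) x : R :=
  2^-1 * \sum_l invmx (G x) k l *
    (partial i (fun z => G z j l) x + partial j (fun z => G z i l) x
     - partial l (fun z => G z i j) x).

Definition nabla a c : field := fun x =>
  'D_(a x) c x
  + \row_k \sum_i \sum_j a x ord0 i * c x ord0 j * christoffel i j k x.

Definition lie_bracket a b : field := fun x => 'D_(a x) b x - 'D_(b x) a x.

Definition curvature_field a b c : field := fun x =>
  nabla a (nabla b c) x - nabla b (nabla a c) x - nabla (lie_bracket a b) c x.

(* By tensoriality, evaluated on extensions with constant components. *)
Definition riemann x : tensor4 R := fun u v w z =>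
  inner (G x) (curvature_field (cst u) (cst v) (cst w) x) z.

End Curvature.

Section Fields.
Variables (R : realType) (M : oriented4Manifold R).
Implicit Types (g h : sym2Field M) (i : atlas_index M) (p : M).

Definition gram_at g i p : 'M[R]_4 := g i (cmap (atlas i) p).

Definition Rm_at g i p : tensor4 R := riemann (g i) (cmap (atlas i) p).

Definition riemannian g : Prop :=
  forall i p, cdom (atlas i) p -> positive_definite (gram_at g i p).

Definition split_signature h : Prop :=
  forall i p, cdom (atlas i) p -> split_form (gram_at h i p).

Definition deformation g h : Prop :=
  forall p, exists i (U : set M) (E : 'rV[R]_4 -> 'M[R]_4),
    [/\ open U, U p, U `<=` cdom (atlas i),
        forall a b : 'I_4, smooth_on (cmap (atlas i) @` U) (fun x => E x a b) &
        forall q, U q ->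
          orthonormal (gram_at g i q) (E (cmap (atlas i) q)) /\
          orthonormal (gram_at h i q) (E (cmap (atlas i) q))].

Definition Rhat g i p : 'M[R]_4 -> 'M[R]_4 :=
  curvature_operator (gram_at g i p) (Rm_at g i p).

Definition star h i p : 'M[R]_4 -> 'M[R]_4 := hodge_star (gram_at h i p).

Definition star_einstein g h : Prop :=
  forall i p, cdom (atlas i) p -> forall A, bivector A ->
    Rhat g i p (star h i p A) = star h i p (Rhat g i p A).

Definition tr_Rm h g i p : 'rV[R]_4 -> 'rV[R]_4 -> R :=
  trace14 (gram_at h i p) (Rm_at g i p).

Definition is_plane g i p (P : 'M[R]_4) : Prop := plane (gram_at g i p) P.

Definition sec_at g i p (P : 'M[R]_4) : R :=
  sec (gram_at g i p) (Rm_at g i p) P.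

End Fields.

(* Main.v *)
Require Import Defs.
From mathcomp Require Import all_boot all_order all_algebra.
From mathcomp Require Import all_classical all_reals all_analysis.
From mathcomp Require Import ring lra.
Import Order.TTheory GRing.Theory Num.Theory.
Import numFieldNormedType.Exports.
Set Implicit Arguments.
Unset Strict Implicit.
Unset Printing Implicit Defensive.
Local Open Scope classical_set_scope.
Local Open Scope ring_scope.

(** Everything is decided at a point.  There the deformation hypothesis gives a
    frame e0, e1, e2, e3 orthonormal for both metrics; ordered so that h has the
    signs -, -, +, +, the star S of h exchanges e0/\e1 with e2/\e3, e0/\e2 with
    e1/\e3 and e0/\e3 with -e1/\e2.  So S is an involution of the bivectors and,
    because the frame is also orthonormal for g, an isometry of g, hence
    self-adjoint for g.  Commutation of the curvature operator with S therefore
    says that the symmetric 6 by 6 matrix of curvature components is invariant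
    under S: nine linear equations ([star_commute_components]).

    The trace condition is a proportionality of two symmetric bilinear forms, ten
    equations with one unknown f; eliminating f leaves the same nine
    ([trace_components]).  The condition on sectional curvatures says that the
    quadratic form K(SP,SP) - K(P,P) vanishes on decomposable P; polarizing it on
    pairs of frame planes with a common vector gives again the nine equations
    ([sec_components]), and pairs of complementary planes give nothing new since
    S exchanges their members up to sign and K is symmetric.

    Two points of analysis remain.  The curvature is given by a coordinate formula, so
    its symmetries and its independence of the chart have to be derived from that
    formula: both rest on the symmetry of second derivatives ([derive_comm]), the
    first through an expression of the curvature by second derivatives of the
    metric ([riemannE]), the second through the transformation law of the
    connection ([connection_pushforward], [riemann_pushforward]).  Independence of
    the chart makes the factor f of the trace condition a function on the
    manifold; it is smooth because 4 f is the full contraction of the curvature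
    with the inverse of h ([trace_factor_smooth]). *)

(** * Symmetry of second derivatives *)

(** A differential at x also serves any function with the same germ, by uniqueness
    of the first order expansion. *)
Lemma near_eq_differentiable (R : numFieldType) (V W : normedModType R)
    (f g : V -> W) (x : V) :
  (\near x, f x = g x) -> differentiable f x -> differentiable g x.
Proof.
move=> fg df.
have fg0 : \forall h \near 0, f (h + x) = g (h + x).
  move/nbhs_ballP: fg => [d /= d0 fg]; apply/nbhs_ballP; exists d => // h.
  rewrite -ball_normE /= sub0r normrN => hd; apply: fg.
  by rewrite -ball_normE /= opprD addrCA subrr addr0 normrN.
have dg : g \o shift x = cst (g x) + 'd f x +o_ 0 id.
  apply/eqaddoP => e e0.
  have /eqaddoP/(_ e e0) := diff_locally df.
  rewrite (nbhs_singleton fg); apply: filterS2 fg0 => h fgh.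
  by rewrite -[((g \o _) - _) h]/(g (h + x) - _) -fgh.
apply/diff_locallyP.
rewrite (diff_unique (diff_continuous df) dg); split => //.
exact: diff_continuous.
Qed.

Lemma is_derive_line (R : numFieldType) (V W : normedModType R)
    (f : V -> W) (u w : V) (s : R) :
  derivable f (s *: u + w) u ->
  is_derive s 1 (fun r : R => f (r *: u + w)) ('D_u f (s *: u + w)).
Proof.
have E : (fun h : R => h^-1 *: (((fun r : R => f (r *: u + w)) \o shift s) h%:A
            - f (s *: u + w))) =
    (fun h => h^-1 *: ((f \o shift (s *: u + w)) (h *: u) - f (s *: u + w))).
  by apply/funext => h /=; rewrite addrA -scalerDl [h%:A]mulr1.
move=> df; apply: DeriveDef; first by rewrite /derivable E.
by rewrite /derive E.
Qed.

Section Young.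
Variables (R : realType) (V : normedModType R).
Implicit Types (f : V -> R) (x u v : V) (t : R).

(** By the mean value theorem along [u], the second difference is t times an
    increment of ['D_u f] along t v, which the differential of ['D_u f] at [x]
    gives up to o(t). *)
Lemma second_difference_approx f x u v (e : R) : 0 < e ->
  (\forall y \near x, differentiable f y) -> differentiable ('D_u f) x ->
  \forall t \near 0^'+,
   `|f (t *: u + (t *: v + x)) - f (t *: u + x) - f (t *: v + x) + f x
      - t ^+ 2 * 'D_v ('D_u f) x| <= e * t ^+ 2.
Proof.
move=> e0 df dF.
(* N turns two errors of size (e/N) t (|u| + |v|) into at most e t. *)
set N := 2 * (`|u| + `|v| + 1).
have N0 : 0 < N by rewrite /N; have := normr_ge0 u; have := normr_ge0 v; lra.
have eN : 0 < e / N by rewrite divr_gt0.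
have /eqaddoP/(_ _ eN) := diff_locally dF.
move=> /nbhs_ballP[d /= d0 hd].
move: df => /nbhs_ballP[d' /= d'0 hd'].
near=> t.
have t0 : 0 < t by near: t; exact: nbhs_right_gt.
have tsmall : t < Num.min d d' / N.
  by near: t; apply: nbhs_right_lt; rewrite divr_gt0// lt_min d0.
have small (h : V) : `|h| <= t * (`|u| + `|v|) -> `|h| < d /\ `|h| < d'.
  move: tsmall; rewrite ltr_pdivlMr// lt_min => /andP[td td'] hle.
  have : t * (`|u| + `|v|) <= t * N.
    by rewrite ler_pM2l// /N; have := normr_ge0 u; have := normr_ge0 v; lra.
  by move=> tN; split; lra.
have box (s r : R) : 0 <= s <= t -> 0 <= r <= t ->
    `|s *: u + r *: v| <= t * (`|u| + `|v|).
  move=> /andP[s0 st] /andP[r0 rt]; rewrite (le_trans (ler_normD _ _))//.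
  by rewrite !normrZ !ger0_norm// mulrDr lerD// ler_wpM2r.
have dbox (s r : R) : 0 <= s <= t -> 0 <= r <= t ->
    differentiable f (s *: u + (r *: v + x)).
  move=> s0 r0; apply: hd'; rewrite -ball_normE /=.
  by rewrite addrA opprD addrCA subrr addr0 normrN; have [] := small _ (box _ _ s0 r0).
have Fbox (s r : R) : 0 <= s <= t -> 0 <= r <= t ->
    `|'D_u f (s *: u + (r *: v + x)) - ('D_u f x + 'd ('D_u f) x (s *: u + r *: v))|
      <= e / N * (t * (`|u| + `|v|)).
  move=> s0 r0; have [sd _] := small _ (box _ _ s0 r0).
  have /hd : ball 0 d (s *: u + r *: v) by rewrite -ball_normE /= sub0r normrN.
  rewrite -[(_ - _) _]/('D_u f (_ + x) - _) -addrA => /le_trans; apply.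
  by rewrite ler_wpM2l ?box// ltW.
pose phi (s : R) := f (s *: u + (t *: v + x)) - f (s *: u + x).
have t1 : 0 <= t <= t by rewrite lexx ltW.
have z1 : 0 <= (0 : R) <= t by rewrite /= lexx ltW.
have der (s : R) : 0 <= s <= t -> is_derive s 1 phi
   ('D_u f (s *: u + (t *: v + x)) - 'D_u f (s *: u + x)).
  move=> st; have d1 := is_derive_line (diff_derivable (v := u) (dbox s t st t1)).
  have := dbox s 0 st z1; rewrite scale0r add0r => d2.
  have {}d2 := is_derive_line (diff_derivable (v := u) d2).
  exact: is_deriveB.
have [c /= cin] : exists2 c, c \in `]0, t[ & phi t - phi 0 =
    ('D_u f (c *: u + (t *: v + x)) - 'D_u f (c *: u + x)) * (t - 0).
  apply: MVT => // [s sin|].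
    by apply: der; move: sin; rewrite in_itv/= => /andP[/ltW-> /ltW->].
  apply: derivable_within_continuous => s sin.
  by apply: ex_derive; apply: der; move: sin; rewrite in_itv.
have ct : 0 <= c <= t by move: cin; rewrite in_itv/= => /andP[/ltW-> /ltW->].
have k_small : 2 * (e / N * (t * (`|u| + `|v|))) <= e * t.
  rewrite (_ : 2 * _ = e * t * (2 * (`|u| + `|v|) / N)); last by field; rewrite gt_eqF.
  rewrite ler_piMr ?mulr_ge0 ?(ltW t0) ?(ltW e0)// ler_pdivrMr// mul1r /N; lra.
have := Fbox c t ct t1; have := Fbox c 0 ct z1.
have -> : 'd ('D_u f) x (c *: u + t *: v) =
    'd ('D_u f) x (c *: u) + t * 'D_v ('D_u f) x.
  by rewrite linearD/=; congr (_ + _); rewrite linearZ/= deriveE.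
rewrite !scale0r !add0r addr0.
rewrite /phi scale0r !add0r subr0; move: k_small.
set k := e / N * _; set A := 'D_u f _; set B := 'D_u f (_ + (_ + _)).
rewrite !ler_norml => k_small /andP[b1 b2] /andP[a1 a2] dphi.
rewrite (_ : f _ - _ - _ + _ = (B - A) * t); last by rewrite -dphi; ring.
set D := 'D_v _ _ in a1 a2 b1 b2 *; set d1 := 'd _ _ _ in a1 a2 b1 b2.
rewrite (_ : _ - _ = t * (B - A - t * D)); last by ring.
have BA : `|B - A - t * D| <= e * t by rewrite ler_norml; apply/andP; split; lra.
rewrite -ler_norml normrM (ger0_norm (ltW t0)).
by rewrite (_ : e * t ^+ 2 = t * (e * t)) ?ler_pM2l//; ring.
Unshelve. all: by end_near. Qed.

(** Both orders of differentiation are the limit of the same second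
    difference quotient. *)
Lemma derive_comm f x u v :
  (\forall y \near x, differentiable f y) ->
  differentiable ('D_u f) x -> differentiable ('D_v f) x ->
  'D_u ('D_v f) x = 'D_v ('D_u f) x.
Proof.
move=> df du dv; apply/eqP; rewrite -subr_eq0 -normr_eq0 //.
rewrite eq_le normr_ge0 andbT; apply/ler_addgt0Pl => e e0; rewrite addr0.
have e2 : 0 < e / 2 by rewrite divr_gt0.
have au := second_difference_approx v e2 df du.
have av := second_difference_approx u e2 df dv.
have [t [t0 tu tv]] : exists t, [/\ 0 < t,
   `|f (t *: u + (t *: v + x)) - f (t *: u + x) - f (t *: v + x) + f x
      - t ^+ 2 * 'D_v ('D_u f) x| <= e / 2 * t ^+ 2 &
   `|f (t *: v + (t *: u + x)) - f (t *: v + x) - f (t *: u + x) + f x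
      - t ^+ 2 * 'D_u ('D_v f) x| <= e / 2 * t ^+ 2].
  have := filterI (nbhs_right_gt 0) (filterI au av).
  move=> /(_ _ _)/(@filter_ex _ _ (at_right_proper_filter (0 : R))).
  by move=> [t [t0 [tu tv]]]; exists t; exact: And3 t0 tu tv.
rewrite addrCA in tv; move: tu tv; set P := f (_ + _) - _ - _ + _.
rewrite (_ : f (_ + _) - _ - _ + _ = P); last by rewrite /P; ring.
move=> /ler_normlP[a1 a2] /ler_normlP[b1 b2]; apply/ler_normlP.
have tt : 0 < t ^+ 2 by rewrite exprn_gt0.
move: P ('D_u _ x) ('D_v _ x) a1 a2 b1 b2 => P A B a1 a2 b1 b2.
by split; rewrite -(ler_pM2l tt); lra.
Qed.

End Young.

(** * Smooth functions and matrix fields *)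

Section SmoothCalculus.
Variables (R : realType) (U : set 'rV[R]_4).
Hypothesis Uopen : open U.
Implicit Types (f g : 'rV[R]_4 -> R) (x v : 'rV[R]_4).

(** [smooth_on] quantifies over words of directions of any length; bounding the
    length gives classes C^n whose closure properties follow by induction on n. *)
Let Cn (n : nat) f := forall (vs : seq 'rV[R]_4) x, (size vs <= n)%N -> U x ->
  differentiable (foldr (fun v k => 'D_v k) f vs) x.

Let smooth_onP f : smooth_on U f <-> forall n, Cn n f.
Proof.
split=> [sf n vs x _|sf vs x]; first exact: sf.
exact: (sf (size vs)).
Qed.

Let CnS n f : Cn n.+1 f <->
  (forall x, U x -> differentiable f x) /\ forall v, Cn n ('D_v f).
Proof.
split=> [Cf|[df Cf] vs x].
  split=> [x Ux|v vs x sz Ux]; first exact: (Cf [::]).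
  by have := Cf (rcons vs v) x; rewrite foldr_rcons size_rcons; apply.
case/lastP: vs => [|vs v]; first by move=> _; apply: df.
by rewrite foldr_rcons size_rcons ltnS; apply: Cf.
Qed.

Lemma derive_eq_on (W : normedModType R) (f g : 'rV[R]_4 -> W) x v :
  (forall y, U y -> f y = g y) -> U x -> 'D_v f x = 'D_v g x.
Proof.
move=> fg Ux; apply: near_eq_derive.
by apply: filterS (open_nbhs_nbhs (conj Uopen Ux)) => y /fg.
Qed.


Let Cn_ext n f g : (forall x, U x -> f x = g x) -> Cn n f -> Cn n g.
Proof.
have diff_eq_on f' g' x : (forall x, U x -> f' x = g' x) -> U x ->
    differentiable f' x -> differentiable g' x.
  move=> fg Ux; apply: near_eq_differentiable.
  by apply: filterS (open_nbhs_nbhs (conj Uopen Ux)) => y /fg.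
elim: n f g => [|n IH] f g fg.
  by move=> Cf [|//] x _ Ux /=; apply: (diff_eq_on _ _ _ fg Ux); exact: (Cf [::]).
move=> /CnS[df Cf]; apply/CnS; split=> [x Ux|v].
  by apply: (diff_eq_on _ _ _ fg Ux); exact: df.
by apply: IH (Cf v) => x Ux; exact: derive_eq_on.
Qed.

Let CnW n f : Cn n.+1 f -> Cn n f.
Proof. by move=> Cf vs x sz; apply: Cf; exact: leqW. Qed.

Lemma smooth_on_ext f g :
  (forall x, U x -> f x = g x) -> smooth_on U f -> smooth_on U g.
Proof. by move=> fg /smooth_onP sf; apply/smooth_onP => n; exact: Cn_ext (sf n). Qed.

Lemma smooth_on_differentiable f x : smooth_on U f -> U x -> differentiable f x.
Proof. by move=> sf; apply: (sf [::]). Qed.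

Lemma smooth_on_derive f v : smooth_on U f -> smooth_on U ('D_v f).
Proof.
by move=> /smooth_onP sf; apply/smooth_onP => n; have /CnS[] := sf n.+1.
Qed.

Lemma smooth_on_cst (a : R) : smooth_on U (cst a).
Proof.
apply/smooth_onP => n; elim: n a => [|n IH] a.
  by move=> [|//] x _ _ /=; exact: differentiable_cst.
apply/CnS; split=> [x _|v]; first exact: differentiable_cst.
by apply: Cn_ext (IH 0) => x _; rewrite derive_cst.
Qed.

Let CnD n f g : Cn n f -> Cn n g -> Cn n (fun x => f x + g x).
Proof.
elim: n f g => [|n IH] f g.
  move=> Cf Cg [|//] x _ Ux /=.
  by apply: differentiableD; [exact: (Cf [::])|exact: (Cg [::])].
move=> /CnS[df Cf] /CnS[dg Cg]; apply/CnS; split=> [x Ux|v].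
  by apply: differentiableD; [exact: df|exact: dg].
apply: Cn_ext (IH _ _ (Cf v) (Cg v)) => x Ux.
by rewrite deriveD //; apply: diff_derivable; [exact: df|exact: dg].
Qed.

Lemma smooth_onD f g :
  smooth_on U f -> smooth_on U g -> smooth_on U (fun x => f x + g x).
Proof.
by move=> /smooth_onP sf /smooth_onP sg; apply/smooth_onP => n; exact: CnD.
Qed.

Let CnM n f g : Cn n f -> Cn n g -> Cn n (fun x => f x * g x).
Proof.
elim: n f g => [|n IH] f g.
  move=> Cf Cg [|//] x _ Ux /=.
  by apply: differentiableM; [exact: (Cf [::])|exact: (Cg [::])].
move=> Cf' Cg'; have [df Cf] := (CnS _ _).1 Cf'; have [dg Cg] := (CnS _ _).1 Cg'.
apply/CnS; split=> [x Ux|v].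
  by apply: differentiableM; [exact: df|exact: dg].
apply: Cn_ext (CnD (IH _ _ (CnW Cf') (Cg v)) (IH _ _ (CnW Cg') (Cf v))) => x Ux.
by rewrite deriveM //; apply: diff_derivable; [exact: df|exact: dg].
Qed.

Lemma smooth_onM f g :
  smooth_on U f -> smooth_on U g -> smooth_on U (fun x => f x * g x).
Proof.
by move=> /smooth_onP sf /smooth_onP sg; apply/smooth_onP => n; exact: CnM.
Qed.

Lemma smooth_onV f : (forall x, U x -> f x != 0) ->
  smooth_on U f -> smooth_on U (fun x => (f x)^-1).
Proof.
move=> f0 /smooth_onP sf; apply/smooth_onP; elim=> [|n IH].
  move=> [|//] x _ Ux /=.
  by apply: differentiableV; [exact: (sf 0%N [::])|exact: f0].
have [df Cf] := (CnS _ _).1 (sf n.+1).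
apply/CnS; split=> [x Ux|v].
  by apply: differentiableV; [exact: df|exact: f0].
apply: Cn_ext (CnM ((smooth_onP _).1 (smooth_on_cst (-1)) n)
   (CnM (CnM IH IH) (Cf v))) => x Ux.
rewrite deriveV ?f0//; last by apply: diff_derivable; exact: df.
by rewrite /= mulN1r scaleNr expr2 invfM.
Qed.

Lemma smooth_on_sum (I : Type) (r : seq I) (P : pred I) (F : I -> 'rV[R]_4 -> R) :
  (forall i, smooth_on U (F i)) -> smooth_on U (fun x => \sum_(i <- r | P i) F i x).
Proof.
move=> sF; elim: r => [|i r IH].
  by apply: smooth_on_ext (smooth_on_cst 0) => x _; rewrite big_nil.
case Pi: (P i); last by apply: smooth_on_ext IH => x _; rewrite big_cons Pi.
by apply: smooth_on_ext (smooth_onD (sF i) IH) => x _; rewrite big_cons Pi.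
Qed.

Lemma smooth_on_prod (I : Type) (r : seq I) (P : pred I) (F : I -> 'rV[R]_4 -> R) :
  (forall i, smooth_on U (F i)) -> smooth_on U (fun x => \prod_(i <- r | P i) F i x).
Proof.
move=> sF; elim: r => [|i r IH].
  by apply: smooth_on_ext (smooth_on_cst 1) => x _; rewrite big_nil.
case Pi: (P i); last by apply: smooth_on_ext IH => x _; rewrite big_cons Pi.
by apply: smooth_on_ext (smooth_onM (sF i) IH) => x _; rewrite big_cons Pi.
Qed.

Definition smooth_mx m n (A : 'rV[R]_4 -> 'M[R]_(m, n)) :=
  forall i j, smooth_on U (fun x => A x i j).

Lemma smooth_mx_ext m n (A B : 'rV[R]_4 -> 'M[R]_(m, n)) :
  (forall x, U x -> A x = B x) -> smooth_mx A -> smooth_mx B.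
Proof. by move=> AB sA i j; apply: smooth_on_ext (sA i j) => x /AB->. Qed.

Lemma smooth_mx_derivable m n (A : 'rV[R]_4 -> 'M[R]_(m, n)) x v :
  smooth_mx A -> U x -> derivable A x v.
Proof.
move=> sA Ux; apply/derivable_mxP => i j.
by apply: diff_derivable; exact: smooth_on_differentiable (sA i j) Ux.
Qed.

Lemma smooth_mx_cst m n (A : 'M[R]_(m, n)) : smooth_mx (cst A).
Proof. by move=> i j; exact: smooth_on_cst. Qed.

Lemma smooth_mxD m n (A B : 'rV[R]_4 -> 'M[R]_(m, n)) :
  smooth_mx A -> smooth_mx B -> smooth_mx (fun x => A x + B x).
Proof.
move=> sA sB i j; apply: smooth_on_ext (smooth_onD (sA i j) (sB i j)) => x _.
by rewrite mxE.
Qed.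

Lemma smooth_mxM m n p (A : 'rV[R]_4 -> 'M[R]_(m, n)) (B : 'rV[R]_4 -> 'M[R]_(n, p)) :
  smooth_mx A -> smooth_mx B -> smooth_mx (fun x => A x *m B x).
Proof.
move=> sA sB i j.
apply: (@smooth_on_ext (fun x => \sum_k A x i k * B x k j)) => [x _|].
  by rewrite mxE.
by apply: smooth_on_sum => k; exact: smooth_onM.
Qed.

Lemma smooth_mx_tr m n (A : 'rV[R]_4 -> 'M[R]_(m, n)) :
  smooth_mx A -> smooth_mx (fun x => (A x)^T).
Proof. by move=> sA i j; apply: smooth_on_ext (sA j i) => x _; rewrite mxE. Qed.

Lemma smooth_mxN m n (A : 'rV[R]_4 -> 'M[R]_(m, n)) :
  smooth_mx A -> smooth_mx (fun x => - A x).
Proof.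
move=> sA i j; apply: smooth_on_ext (smooth_onM (smooth_on_cst (-1)) (sA i j)).
by move=> x _; rewrite mxE /= mulN1r.
Qed.

Lemma smooth_mx_derive m n (A : 'rV[R]_4 -> 'M[R]_(m, n)) v :
  smooth_mx A -> smooth_mx ('D_v A).
Proof.
move=> sA i j; apply: smooth_on_ext (smooth_on_derive v (sA i j)) => x Ux.
by rewrite derive_mx ?mxE//; exact: smooth_mx_derivable.
Qed.

Lemma smooth_on_det n (A : 'rV[R]_4 -> 'M[R]_n) :
  smooth_mx A -> smooth_on U (fun x => \det (A x)).
Proof.
move=> sA; apply: smooth_on_sum => s; apply: smooth_onM; first exact: smooth_on_cst.
by apply: smooth_on_prod => i; exact: sA.
Qed.

(** By Cramer's rule the entries of the inverse are quotients of polynomials in the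
    entries. *)
Lemma smooth_mx_inv n (A : 'rV[R]_4 -> 'M[R]_n) :
  (forall x, U x -> A x \in unitmx) -> smooth_mx A ->
  smooth_mx (fun x => invmx (A x)).
Proof.
move=> uA sA i j.
apply: (@smooth_on_ext (fun x => (\det (A x))^-1 * cofactor (A x) j i)) => [x Ux|].
  by rewrite /invmx uA// !mxE.
apply: smooth_onM.
  apply: smooth_onV (smooth_on_det sA) => x /uA.
  by rewrite unitmxE unitfE.
apply: smooth_onM; first exact: smooth_on_cst.
apply: smooth_on_det => a b.
by apply: smooth_on_ext (sA (lift j a) (lift i b)) => x _; rewrite !mxE.
Qed.

Lemma derive_mx_comm m n (A : 'rV[R]_4 -> 'M[R]_(m, n)) u v x :
  smooth_mx A -> U x -> 'D_u ('D_v A) x = 'D_v ('D_u A) x.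
Proof.
move=> sA Ux.
have E a b i j : 'D_a ('D_b A) x i j = 'D_a ('D_b (fun y => A y i j)) x.
  rewrite derive_mx ?mxE; last exact/smooth_mx_derivable/Ux/smooth_mx_derive.
  apply: near_eq_derive; apply: filterS (open_nbhs_nbhs (conj Uopen Ux)) => y Uy.
  by rewrite derive_mx ?mxE//; exact: smooth_mx_derivable.
apply/matrixP => i j.
apply: etrans (E u v i j) _.
apply: etrans _ (esym (E v u i j)).
apply: (@derive_comm _ _ (fun y => A y i j)).
- apply: filterS (open_nbhs_nbhs (conj Uopen Ux)) => y.
  exact: smooth_on_differentiable.
- exact/smooth_on_differentiable/Ux/smooth_on_derive.
- exact/smooth_on_differentiable/Ux/smooth_on_derive.
Qed.

End SmoothCalculus.

(** The product rules for a metric evaluated on two vector fields and for a field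
    multiplied by a Jacobian matrix are all instances of this one. *)
Lemma derive_mulmx (R : realFieldType) (V : normedModType R) (m n p : nat)
    (A : V -> 'M[R]_(m, n)) (B : V -> 'M[R]_(n, p)) (x u : V) :
  derivable A x u -> derivable B x u ->
  derivable (fun y => A y *m B y) x u /\
  'D_u (fun y => A y *m B y) x = 'D_u A x *m B x + A x *m 'D_u B x.
Proof.
move=> dA dB.
have dE i j : is_derive x u (fun y => (A y *m B y) i j)
    (('D_u A x *m B x + A x *m 'D_u B x) i j).
  rewrite (_ : (fun y => _) =
      \sum_k ((fun y => A y i k) * (fun y => B y k j))); last first.
    by apply/funext => y; rewrite mxE fct_sumE.
  apply: is_derive_eq.
    apply: is_derive_sum => k; apply: is_deriveM; apply: derivableP.
      by have /derivable_mxP := dA; apply.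
    by have /derivable_mxP := dB; apply.
  rewrite !mxE -big_split /=; apply: eq_bigr => k _.
  by rewrite !derive_mx// !mxE addrC /GRing.scale/= [in X in _ + X]mulrC.
have d : derivable (fun y => A y *m B y) x u.
  by apply/derivable_mxP => i j; exact: ex_derive.
split=> //; rewrite derive_mx//; apply/matrixP => i j.
by rewrite mxE; exact: derive_val.
Qed.

Lemma derive_trmx (R : realFieldType) (V : normedModType R) (m n : nat)
    (A : V -> 'M[R]_(m, n)) (x u : V) :
  derivable A x u ->
  derivable (fun y => (A y)^T) x u /\ 'D_u (fun y => (A y)^T) x = ('D_u A x)^T.
Proof.
move=> dA; have d : derivable (fun y => (A y)^T) x u.
  apply/derivable_mxP => i j; have /derivable_mxP/(_ j i) := dA.
  rewrite (_ : (fun y => A y j i) = (fun y => (A y)^T i j))//.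
  by apply/funext => y; rewrite mxE.
split=> //; rewrite !derive_mx//; apply/matrixP => i j; rewrite !mxE.
by congr ('D_u _ x); apply/funext => y; rewrite mxE.
Qed.

(** * Bilinear forms on tangent vectors *)

Section Inner.
Variable R : realType.
Implicit Types (m : 'M[R]_4) (u v w z : 'rV[R]_4) (a : R).

Lemma innerE m v w : inner m v w = (v *m m *m w^T) 0 0.
Proof. by []. Qed.

Lemma inner0l m w : inner m 0 w = 0.
Proof. by rewrite /inner !mul0mx mxE. Qed.

Lemma inner0r m w : inner m w 0 = 0.
Proof. by rewrite /inner trmx0 mulmx0 mxE. Qed.

Lemma innerDl m u v w : inner m (u + v) w = inner m u w + inner m v w.
Proof. by rewrite /inner !mulmxDl mxE. Qed.

Lemma innerDr m u v w : inner m w (u + v) = inner m w u + inner m w v.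
Proof. by rewrite /inner linearD/= !mulmxDr mxE. Qed.

Lemma innerZl m a v w : inner m (a *: v) w = a * inner m v w.
Proof. by rewrite /inner -!scalemxAl mxE. Qed.

Lemma innerZr m a v w : inner m w (a *: v) = a * inner m w v.
Proof. by rewrite /inner linearZ/= -!scalemxAr mxE. Qed.

Lemma innerNl m v w : inner m (- v) w = - inner m v w.
Proof. by rewrite -scaleN1r innerZl mulN1r. Qed.

Lemma innerDm m n v w : inner (m + n) v w = inner m v w + inner n v w.
Proof. by rewrite /inner mulmxDr mulmxDl mxE. Qed.

Lemma innerZm m a v w : inner (a *: m) v w = a * inner m v w.
Proof. by rewrite /inner -scalemxAr -scalemxAl mxE. Qed.

Lemma inner_sym m v w : m^T = m -> inner m v w = inner m w v.
Proof.
move=> sm; rewrite /inner -[in RHS]sm -[RHS]/((w *m m^T *m v^T) 0 0).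
by rewrite -[w in RHS]trmxK -!trmx_mul [in RHS]mxE mulmxA.
Qed.

Lemma inner_delta m (i j : 'I_4) : inner m (delta_mx 0 i) (delta_mx 0 j) = m i j.
Proof. by rewrite /inner -rowE trmx_delta -colE !mxE. Qed.

Lemma inner_pullback m (J : 'M[R]_4) v w :
  inner (J *m m *m J^T) v w = inner m (v *m J) (w *m J).
Proof. by rewrite /inner trmx_mul !mulmxA. Qed.

Lemma inner_nondeg m u v : m \in unitmx ->
  (forall w, inner m u w = inner m v w) -> u = v.
Proof.
move=> um uv; apply: (can_inj (mulmxK um)); apply/rowP => j.
have := uv (delta_mx 0 j).
by rewrite /inner trmx_delta -!colE !mxE.
Qed.

Section LinearMap.
Variables (V W : lmodType R) (F : V -> W).
Hypothesis Fl : linear F.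

Lemma linear_map0 : F 0 = 0.
Proof. by have := Fl (-1) 0 0; rewrite scaler0 addr0 scaleN1r addNr. Qed.

Lemma linear_mapN (p : V) : F (- p) = - F p.
Proof. by have := Fl (-1) p 0; rewrite linear_map0 !addr0 !scaleN1r. Qed.

Lemma linear_map_comb a b (p q : V) : F (a *: p + b *: q) = a *: F p + b *: F q.
Proof. by rewrite Fl; congr (_ + _); have := Fl b q 0; rewrite linear_map0 !addr0. Qed.

End LinearMap.

Section ScalarForm.
Variables (V : lmodType R) (f : V -> R).
Hypothesis fl : scalar f.

Lemma scalar_form0 : f 0 = 0.
Proof. by have := fl (-1) 0 0; rewrite scaler0 addr0 mulN1r addNr. Qed.

Lemma scalar_formD (p q : V) : f (p + q) = f p + f q.
Proof. by have := fl 1 p q; rewrite scale1r mul1r. Qed.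

Lemma scalar_formZ a (p : V) : f (a *: p) = a * f p.
Proof. by have := fl a p 0; rewrite scalar_form0 !addr0. Qed.

Lemma scalar_formN (p : V) : f (- p) = - f p.
Proof. by rewrite -scaleN1r scalar_formZ mulN1r. Qed.

Lemma scalar_form6 (p1 p2 p3 p4 p5 p6 : V) (a1 a2 a3 a4 a5 a6 : R) :
  f (a1 *: p1 + a2 *: p2 + a3 *: p3 + a4 *: p4 + a5 *: p5 + a6 *: p6) =
  a1 * f p1 + a2 * f p2 + a3 * f p3 + a4 * f p4 + a5 * f p5 + a6 * f p6.
Proof. by rewrite !scalar_formD !scalar_formZ. Qed.

Lemma scalar_sum (I : finType) (c : I -> R) (F : I -> V) :
  f (\sum_i c i *: F i) = \sum_i c i * f (F i).
Proof. by elim/big_rec2: _ => [|i y z _ <-]; rewrite ?scalar_form0 ?fl. Qed.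

End ScalarForm.

Lemma inner_scalar_l m w : scalar (inner m ^~ w).
Proof. by move=> a u v; rewrite innerDl innerZl. Qed.

Lemma inner_scalar_r m w : scalar (inner m w).
Proof. by move=> a u v; rewrite innerDr innerZr. Qed.

Lemma bilinear_delta (f g : 'rV[R]_4 -> 'rV[R]_4 -> R) :
  (forall w, scalar (f^~ w)) -> (forall v, scalar (f v)) ->
  (forall w, scalar (g^~ w)) -> (forall v, scalar (g v)) ->
  (forall i j, f (delta_mx 0 i) (delta_mx 0 j) = g (delta_mx 0 i) (delta_mx 0 j)) ->
  forall v w, f v w = g v w.
Proof.
move=> fl fr gl gr fg v w; rewrite (row_sum_delta v) (row_sum_delta w).
rewrite (scalar_sum (fl _)) (scalar_sum (gl _)); apply: eq_bigr => i _.
rewrite (scalar_sum (fr _)) (scalar_sum (gr _)); congr (_ * _).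
by apply: eq_bigr => j _; rewrite fg.
Qed.

End Inner.

Section DeriveInner.
Variable R : realType.
Implicit Types (x u : 'rV[R]_4).

Lemma is_derive_inner (H : 'rV[R]_4 -> 'M[R]_4) (a b : 'rV[R]_4 -> 'rV[R]_4) x u :
  derivable H x u -> derivable a x u -> derivable b x u ->
  is_derive x u (fun y => inner (H y) (a y) (b y))
    (inner ('D_u H x) (a x) (b x) + inner (H x) ('D_u a x) (b x)
     + inner (H x) (a x) ('D_u b x)).
Proof.
move=> dH da db.
have [d1 e1] := derive_mulmx da dH.
have [d2 e2] := derive_trmx db.
have [d3 e3] := derive_mulmx d1 d2.
apply: DeriveDef; first by have /derivable_mxP := d3; apply.
have -> : 'D_u (fun y => inner (H y) (a y) (b y)) x =
    'D_u (fun y => a y *m H y *m (b y)^T) x 0 0 by rewrite derive_mx// mxE.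
have addE (A B : 'M[R]_1) : (A + B) 0 0 = A 0 0 + B 0 0 by rewrite mxE.
by rewrite e3 e1 e2 mulmxDl !addE; congr (_ + _); rewrite addrC.
Qed.

Lemma derive_inner (H : 'rV[R]_4 -> 'M[R]_4) (a b : 'rV[R]_4 -> 'rV[R]_4) x u :
  derivable H x u -> derivable a x u -> derivable b x u ->
  'D_u (fun y => inner (H y) (a y) (b y)) x =
  inner ('D_u H x) (a x) (b x) + inner (H x) ('D_u a x) (b x)
  + inner (H x) (a x) ('D_u b x).
Proof. by move=> dH da db; have := is_derive_inner dH da db => -[]. Qed.

End DeriveInner.

(** * The connection and the symmetries of the curvature *)

Lemma derive_mx_linear (R : realType) (U : set 'rV[R]_4) m n
    (A : 'rV[R]_4 -> 'M[R]_(m, n)) x (a : R) u v :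
  smooth_mx U A -> U x -> 'D_(a *: u + v) A x = a *: 'D_u A x + 'D_v A x.
Proof.
move=> sA Ux; apply/matrixP => i j.
have dA := smooth_on_differentiable (sA i j) Ux.
have dmx w : derivable A x w by exact: smooth_mx_derivable sA Ux.
by rewrite !derive_mx// !mxE !deriveE// linearP.
Qed.

(** The algebraic part of the Koszul formula.  [D u] stands for the derivative of
    the metric along [u] at a point, and is kept abstract because the identities
    are needed both for a metric and for its pullback. *)
Section KoszulForm.
Variables (R : realType) (D : 'rV[R]_4 -> 'M[R]_4).
Implicit Types u v w z : 'rV[R]_4.

Definition koszul_form v w z : R :=
  2^-1 * (inner (D v) w z + inner (D w) v z - inner (D z) v w).

Hypothesis symD : forall u, (D u)^T = D u.

Lemma koszul_form_sym v w z : koszul_form v w z = koszul_form w v z.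
Proof.
rewrite /koszul_form (inner_sym w v (symD z)).
by congr (_ * (_ - _)); rewrite addrC.
Qed.

(** Summing the formula over the two orders of the last arguments leaves only the
    derivative of the metric: this is what makes the connection metric. *)
Lemma koszul_form_compat u v w :
  inner (D u) v w = koszul_form u v w + koszul_form u w v.
Proof.
rewrite /koszul_form (inner_sym u v (symD w)) (inner_sym u w (symD v)).
by rewrite (inner_sym w v (symD u)); field.
Qed.

Hypothesis linD : forall a u v, D (a *: u + v) = a *: D u + D v.

Lemma koszul_form_l w z : scalar (fun v => koszul_form v w z).
Proof.
move=> a u v; rewrite /koszul_form linD innerDm innerZm.
by rewrite !innerDl !innerZl; ring.
Qed.

Lemma koszul_form_m v z : scalar (fun w => koszul_form v w z).
Proof. by move=> a u w; rewrite koszul_form_sym koszul_form_l !(koszul_form_sym v). Qed.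

Lemma koszul_form_r v w : scalar (koszul_form v w).
Proof.
move=> a u z; rewrite /koszul_form linD innerDm innerZm.
by rewrite !innerDr !innerZr; ring.
Qed.

End KoszulForm.

(** Linearity is asked in one slot only: the symmetries carry it to the others. *)
Definition curvature_like (R : realType) (T : tensor4 R) : Prop :=
  [/\ forall v w z, scalar (fun u => T u v w z),
      forall u v w z, T v u w z = - T u v w z &
      forall u v w z, T w z u v = T u v w z].

(** The classical expression of the fully covariant curvature at a point by the
    value [g] of the metric, its second derivatives [H] and its connection [C]; the
    symmetries of a curvature tensor are visible on it. *)
Section CurvatureForm.
Variables (R : realType) (g : 'M[R]_4) (H : 'rV[R]_4 -> 'rV[R]_4 -> 'M[R]_4)
  (C : 'rV[R]_4 -> 'rV[R]_4 -> 'rV[R]_4).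

Definition curvature_form : tensor4 R := fun u v w z =>
  2^-1 * (inner (H u w) v z - inner (H u z) v w
          - inner (H v w) u z + inner (H v z) u w)
  - inner g (C u z) (C v w) + inner g (C v z) (C u w).

Lemma curvature_form_like : g^T = g ->
  (forall u v, (H u v)^T = H u v) -> (forall u v, H v u = H u v) ->
  (forall a u v w, H (a *: u + v) w = a *: H u w + H v w) ->
  (forall u v, C v u = C u v) ->
  (forall a u v w, C (a *: u + v) w = a *: C u w + C v w) ->
  curvature_like curvature_form.
Proof.
move=> sg sH cH lH cC lC; rewrite /curvature_form; split.
- move=> v w z a u u'; rewrite !lH !lC.
  by rewrite !(innerDl, innerZl, innerDm, innerZm, innerDr, innerZr); ring.
- by move=> u v w z; ring.
- move=> u v w z; rewrite (cH u w) (cH v w) (cH u z) (cH v z) (cC v w) (cC u z).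
  rewrite (inner_sym z v (sH _ _)) (inner_sym z u (sH _ _)).
  rewrite (inner_sym w v (sH _ _)) (inner_sym w u (sH _ _)).
  rewrite (cC u w) (cC v z) (inner_sym (C v w) _ sg) (inner_sym (C v z) _ sg).
  by rewrite (inner_sym (C u w) _ sg); ring.
Qed.

End CurvatureForm.

Section Connection.
Variables (R : realType) (G : 'rV[R]_4 -> 'M[R]_4).
Implicit Types (x u v w z : 'rV[R]_4).

Definition christoffel_mx (k : 'I_4) x : 'M[R]_4 :=
  \matrix_(i, j) christoffel G i j k x.

Definition connection x v w : 'rV[R]_4 :=
  \row_k inner (christoffel_mx k x) v w.

Definition koszul x v w z : R := koszul_form (fun u => 'D_u G x) v w z.

Lemma connectionDl x (a : R) u v w :
  connection x (a *: u + v) w = a *: connection x u w + connection x v w.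
Proof. by apply/rowP => k; rewrite !mxE inner_scalar_l. Qed.

Lemma connectionDr x (a : R) u v w :
  connection x w (a *: u + v) = a *: connection x w u + connection x w v.
Proof. by apply/rowP => k; rewrite !mxE inner_scalar_r. Qed.

Lemma connection_addr x u v w :
  connection x w (u + v) = connection x w u + connection x w v.
Proof. by have := connectionDr x 1 u v w; rewrite !scale1r. Qed.

Lemma nabla_cst v (c : 'rV[R]_4 -> 'rV[R]_4) x :
  nabla G (cst v) c x = 'D_v c x + connection x v (c x).
Proof.
congr (_ + _); apply/rowP => k; rewrite !mxE exchange_big innerE mxE.
apply: eq_bigr => j _ /=; rewrite mxE big_distrl; apply: eq_bigr => i _ /=.
by rewrite !mxE mulrAC.
Qed.

(** The curvature on constant vector fields, whose Lie bracket vanishes. *)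
Definition curv x u v w : 'rV[R]_4 :=
  ('D_u (fun y => connection y v w) x + connection x u (connection x v w))
  - ('D_v (fun y => connection y u w) x + connection x v (connection x u w)).

Lemma riemann_curv x u v w z : riemann G x u v w z = inner (G x) (curv x u v w) z.
Proof.
rewrite /riemann /curvature_field; congr (inner _ _ _).
have nablaC a b : nabla G (cst a) (cst b) = fun y => connection y a b.
  by apply/funext => y; rewrite nabla_cst derive_cst add0r.
have -> : lie_bracket (cst u) (cst v) = cst (0 : 'rV[R]_4).
  by apply/funext => y; rewrite /lie_bracket !derive_cst subrr.
rewrite !nablaC !nabla_cst -[RHS]subr0; congr (_ - _).
by apply/rowP => k; rewrite !mxE inner0l.
Qed.

Variable U : set 'rV[R]_4.
Hypothesis Uopen : open U.
Hypothesis smoothG : smooth_mx U G.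
Hypothesis symG : forall x, U x -> (G x)^T = G x.
Hypothesis unitG : forall x, U x -> G x \in unitmx.

Let derivableG x u : U x -> derivable G x u.
Proof. exact: smooth_mx_derivable. Qed.

Lemma derive_metric_sym x u : U x -> ('D_u G x)^T = 'D_u G x.
Proof.
move=> Ux; rewrite -(derive_trmx (@derivableG x u Ux)).2.
exact: (derive_eq_on Uopen).
Qed.

Lemma derive2_metric_sym x u v : U x -> ('D_u ('D_v G) x)^T = 'D_u ('D_v G) x.
Proof.
move=> Ux.
have dD : derivable ('D_v G) x u by exact: smooth_mx_derivable (smooth_mx_derive Uopen _ smoothG) Ux.
rewrite -(derive_trmx dD).2; apply: (derive_eq_on Uopen) => // y Uy.
exact: derive_metric_sym.
Qed.

Let koszul_l x w z : U x -> scalar (fun v => koszul x v w z).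
Proof.
by move=> Ux; apply: koszul_form_l => a u v; exact: derive_mx_linear smoothG Ux.
Qed.

Let koszul_m x v z : U x -> scalar (fun w => koszul x v w z).
Proof.
move=> Ux; apply: koszul_form_m => [u|a u w]; first exact: derive_metric_sym.
exact: derive_mx_linear smoothG Ux.
Qed.

Let koszul_r x v w : U x -> scalar (fun z => koszul x v w z).
Proof.
by move=> Ux; apply: koszul_form_r => a u z; exact: derive_mx_linear smoothG Ux.
Qed.

(** Each Christoffel symbol is a Koszul expression in coordinate vectors contracted
    with the inverse metric; bilinearity extends this to all vectors. *)
Lemma connection_koszul x v w : U x ->
  connection x v w =
  (\row_l koszul x v w (delta_mx 0 l)) *m (invmx (G x))^T.
Proof.
move=> Ux; apply/rowP => k; rewrite !mxE.
apply: (@bilinear_delta _ (inner (christoffel_mx k x))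
  (fun v w => \sum_j (\row_l koszul x v w (delta_mx 0 l)) 0 j
                     * (invmx (G x))^T j k)).
- exact: inner_scalar_l.
- exact: inner_scalar_r.
- move=> w' a u v'; rewrite big_distrr -big_split; apply: eq_bigr => j _ /=.
  by rewrite !mxE koszul_l// mulrDl mulrA.
- move=> v' a u w'; rewrite big_distrr -big_split; apply: eq_bigr => j _ /=.
  by rewrite !mxE koszul_m// mulrDl mulrA.
have pE a b c : partial a (fun y => G y b c) x =
    inner ('D_(delta_mx 0 a) G x) (delta_mx 0 b) (delta_mx 0 c).
  rewrite inner_delta derive_mx ?mxE//; exact: derivableG.
move=> i j; rewrite inner_delta mxE /christoffel big_distrr.
apply: eq_bigr => l _ /=.
rewrite (pE i j l) (pE j i l) (pE l i j) [in RHS]mxE [X in _ = _ * X]mxE.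
by rewrite mulrCA mulrC.
Qed.

(** With the nondegeneracy of the metric, this Koszul formula characterizes the
    connection; its symmetry and its behaviour under pullback are read off it. *)
Lemma inner_connection x v w z : U x ->
  inner (G x) (connection x v w) z = koszul x v w z.
Proof.
move=> Ux; rewrite connection_koszul// innerE trmx_inv symG//.
rewrite mulmxKV ?unitG// mxE [in RHS](row_sum_delta z) (scalar_sum (koszul_r _ _ Ux)).
by apply: eq_bigr => l _; rewrite !mxE mulrC.
Qed.

Lemma connection_sym x v w : U x -> connection x v w = connection x w v.
Proof.
move=> Ux; apply: inner_nondeg (unitG Ux) _ => z.
rewrite !inner_connection//; apply: koszul_form_sym => u.
exact: derive_metric_sym.
Qed.

Lemma smooth_inner (H : 'rV[R]_4 -> 'M[R]_4) (a b : 'rV[R]_4 -> 'rV[R]_4) :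
  smooth_mx U H -> smooth_mx U a -> smooth_mx U b ->
  smooth_on U (fun y => inner (H y) (a y) (b y)).
Proof.
move=> sH sa sb.
have := smooth_mxM Uopen (smooth_mxM Uopen sa sH) (smooth_mx_tr Uopen sb).
by move=> /(_ 0 0); apply: smooth_on_ext => // y _; rewrite innerE.
Qed.

Lemma smooth_koszul v w z : smooth_on U (fun y => koszul y v w z).
Proof.
have sI a b c : smooth_on U (fun y => inner ('D_a G y) b c).
  apply: smooth_inner; first exact: smooth_mx_derive.
    exact: smooth_mx_cst.
  exact: smooth_mx_cst.
apply: smooth_onM => //; first exact: smooth_on_cst.
apply: smooth_onD => //; first exact: smooth_onD.
apply: smooth_on_ext (smooth_onM Uopen (smooth_on_cst Uopen (-1)) (sI z v w)) => // y _.
exact: mulN1r.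
Qed.

Lemma smooth_connection v w : smooth_mx U (fun y => connection y v w).
Proof.
apply: (smooth_mx_ext Uopen (A := fun y =>
   (\row_l koszul y v w (delta_mx 0 l)) *m (invmx (G y))^T)).
  by move=> y Uy; rewrite connection_koszul.
apply: smooth_mxM => //.
  move=> i j; apply: smooth_on_ext (smooth_koszul v w (delta_mx 0 j)) => // y _.
  by rewrite mxE.
by apply: smooth_mx_tr => //; exact: smooth_mx_inv.
Qed.

Lemma smooth_christoffel_mx k : smooth_mx U (christoffel_mx k).
Proof.
move=> i j.
apply: smooth_on_ext (smooth_connection (delta_mx 0 i) (delta_mx 0 j) 0 k) => // y _.
by rewrite mxE inner_delta.
Qed.

Lemma smooth_curv u v w : smooth_mx U (fun x => curv x u v w).
Proof.
have sC a b (c : 'rV[R]_4 -> 'rV[R]_4) : smooth_mx U c ->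
    smooth_mx U (fun x => 'D_a (fun y => connection y b w) x + connection x a (c x)).
  move=> sc; apply: smooth_mxD => //.
    by apply: smooth_mx_derive => //; exact: smooth_connection.
  move=> i k; apply: (smooth_on_ext Uopen
      (f := fun x => inner (christoffel_mx k x) a (c x))).
    by move=> x _; rewrite mxE.
  apply: smooth_inner => //; first exact: smooth_christoffel_mx.
  exact: smooth_mx_cst.
apply: smooth_mxD => //; first exact/sC/smooth_connection.
by apply: smooth_mxN => //; exact/sC/smooth_connection.
Qed.

Lemma smooth_riemann u v w z : smooth_on U (fun x => riemann G x u v w z).
Proof.
apply: (smooth_on_ext Uopen (f := fun x => inner (G x) (curv x u v w) z)).
  by move=> x _; rewrite riemann_curv.
apply: smooth_inner => //; first exact: smooth_curv.
exact: smooth_mx_cst.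
Qed.

(** Differentiating the Koszul formula along [u] gives the lowered derivative of the
    connection as second derivatives of the metric, minus the derivative of the
    metric applied to the connection; metric compatibility turns the latter into
    a product of two connection terms. *)
Lemma riemannE x u v w z : U x ->
  riemann G x u v w z =
  curvature_form (G x) (fun a b => 'D_a ('D_b G) x) (connection x) u v w z.
Proof.
move=> Ux; rewrite riemann_curv.
have dD a b : derivable ('D_a G) x b.
  exact: smooth_mx_derivable (smooth_mx_derive Uopen _ smoothG) Ux.
have dC a b c : derivable (fun y => connection y a b) x c.
  exact: smooth_mx_derivable (smooth_connection _ _) Ux.
have dcst (c : 'rV[R]_4) a : derivable (cst c : 'rV[R]_4 -> 'rV[R]_4) x a.
  exact: derivable_cst.
have [H HE] : exists H, forall a b, H a b = 'D_a ('D_b G) x.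
  by exists (fun a b => 'D_a ('D_b G) x).
have symH a b : H a b = H b a by rewrite !HE; exact: derive_mx_comm smoothG Ux.
have D2 a b c d : 'D_a (fun y => inner ('D_b G y) c d) x = inner (H a b) c d.
  rewrite (derive_inner (dD b a) (dcst c a) (dcst d a)) HE !derive_cst.
  by rewrite inner0r inner0l !addr0.
have half a b : inner (G x) ('D_a (fun y => connection y b w) x
      + connection x a (connection x b w)) z =
    2^-1 * (inner (H a b) w z + inner (H a w) b z
            - inner (H a z) b w)
    - inner (G x) (connection x a z) (connection x b w).
  have : 'D_a (fun y => inner (G y) (connection y b w) z) x =
      'D_a (fun y => koszul y b w z) x.
    by apply: (derive_eq_on Uopen) => // y Uy; rewrite inner_connection.
  rewrite (derive_inner (@derivableG x a Ux) (dC b w a) (dcst z a)) derive_cst.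
  rewrite inner0r addr0.
  have -> : 'D_a (fun y => koszul y b w z) x =
      2^-1 * (inner (H a b) w z + inner (H a w) b z
            - inner (H a z) b w).
    have iI b' c d : is_derive x a (fun y => inner ('D_b' G y) c d)
        (inner (H a b') c d).
      apply: DeriveDef; last exact: D2.
      apply/diff_derivable/(smooth_on_differentiable _ Ux).
      apply: smooth_inner; last exact: smooth_mx_cst; last exact: smooth_mx_cst.
      exact: smooth_mx_derive.
    have iK := is_deriveZ 2^-1 (is_deriveB (is_deriveD (iI b w z) (iI w b z)) (iI z b w)).
    exact: (@derive_val _ _ _ _ _ _ _ iK).
  have symDx : forall c, ('D_c G x)^T = 'D_c G x by move=> c; exact: derive_metric_sym.
  rewrite (koszul_form_compat symDx) innerDl (inner_connection a _ _ Ux).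
  rewrite -[koszul_form _ a _ z]/(koszul x a (connection x b w) z).
  rewrite -[koszul_form _ a z _]/(koszul x a z (connection x b w)).
  rewrite -(inner_connection a z (connection x b w) Ux).
  by move=> <-; ring.
rewrite /curv innerDl innerNl (half u v) (half v u).
have -> : (fun a b => 'D_a ('D_b G) x) = H.
  by apply/funext => a; apply/funext => b; rewrite HE.
rewrite /curvature_form (symH v u).
move: (connection x u z) (connection x v w) (connection x v z) (connection x u w).
by move: (G x) => Gx cuz cvw cvz cuw; ring.
Qed.

Lemma riemann_curvature_like x : U x -> curvature_like (riemann G x).
Proof.
move=> Ux; have -> : riemann G x =
    curvature_form (G x) (fun a b => 'D_a ('D_b G) x) (connection x).
  by do 4 (apply/funext => ?); exact: riemannE.
apply: curvature_form_like.
- exact: symG.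
- by move=> u v; exact: derive2_metric_sym.
- by move=> u v; exact: derive_mx_comm smoothG Ux.
- move=> a u v w; apply: derive_mx_linear Ux.
  exact: smooth_mx_derive smoothG.
- by move=> u v; exact: connection_sym.
- by move=> a u v w; exact: connectionDl.
Qed.

End Connection.

(** * Naturality of the curvature under changes of coordinates *)

Section ChainRule.
Variables (R : realType) (U V : set 'rV[R]_4) (phi : 'rV[R]_4 -> 'rV[R]_4).
Hypothesis smooth_phi : smooth_mx U phi.
Hypothesis phiUV : forall x, U x -> V (phi x).

Lemma smooth_mx_differentiable x : U x -> differentiable phi x.
Proof.
move=> Ux; have -> : phi = \sum_k (fun y => phi y 0 k *: delta_mx 0 k).
  by apply/funext => y; rewrite fct_sumE [LHS]row_sum_delta.
apply: differentiable_sum => k; apply: differentiableZl.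
exact: smooth_on_differentiable (smooth_phi 0 k) Ux.
Qed.

Lemma derive_mx_comp m n (A : 'rV[R]_4 -> 'M[R]_(m, n)) x u :
  smooth_mx V A -> U x ->
  derivable (A \o phi) x u /\ 'D_u (A \o phi) x = 'D_('D_u phi x) A (phi x).
Proof.
move=> sA Ux; have Vx := phiUV Ux.
have dphi := smooth_mx_differentiable Ux.
have dA i j : differentiable (fun y => A y i j) (phi x).
  exact: smooth_on_differentiable (sA i j) Vx.
have dc i j : differentiable ((fun y => A y i j) \o phi) x.
  exact: differentiable_comp.
have d : derivable (A \o phi) x u.
  by apply/derivable_mxP => i j; apply: diff_derivable; exact: dc.
have d' : derivable A (phi x) ('D_u phi x) by exact: smooth_mx_derivable sA Vx.
split; first exact: d.
rewrite (derive_mx d) (derive_mx d'); apply/matrixP => i j; rewrite [LHS]mxE [RHS]mxE.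
apply: etrans (deriveE _ (dc i j)) _; apply: etrans _ (esym (deriveE _ (dA i j))).
have e : 'D_u phi x = 'd phi x u by exact: deriveE.
apply: etrans _ (congr1 ('d (fun y => A y i j) (phi x)) (esym e)).
by have /(congr1 (@^~ u)) := diff_comp dphi (dA i j).
Qed.

End ChainRule.

(** [F] and [S] are the first and second derivatives of a change of coordinates.
    Of the six terms in which [S] enters the Koszul combination, four cancel in
    pairs by the symmetry of [S]. *)
Lemma koszul_form_pullback (R : realType) (D D' : 'rV[R]_4 -> 'M[R]_4)
    (m : 'M[R]_4) (F : 'rV[R]_4 -> 'rV[R]_4) (S : 'rV[R]_4 -> 'rV[R]_4 -> 'rV[R]_4) :
  m^T = m -> (forall u v, S u v = S v u) ->
  (forall u v w, inner (D u) v w = inner (D' (F u)) (F v) (F w)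
     + inner m (S u v) (F w) + inner m (F v) (S u w)) ->
  forall v w z, koszul_form D v w z =
    koszul_form D' (F v) (F w) (F z) + inner m (S v w) (F z).
Proof.
move=> sm cS DF v w z; rewrite /koszul_form !DF.
rewrite (inner_sym (F w) (S v z) sm) (inner_sym (F v) (S w z) sm).
rewrite (inner_sym (F v) (S z w) sm) (cS w v) (cS z v) (cS z w).
by field.
Qed.

Section Naturality.
Variables (R : realType) (U V : set 'rV[R]_4) (phi : 'rV[R]_4 -> 'rV[R]_4).
Variables (G H : 'rV[R]_4 -> 'M[R]_4).
Hypotheses (Uopen : open U) (Vopen : open V).
Hypothesis smooth_phi : smooth_mx U phi.
Hypothesis phiUV : forall x, U x -> V (phi x).
Hypotheses (smoothG : smooth_mx U G) (smoothH : smooth_mx V H).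
Hypothesis symG : forall x, U x -> (G x)^T = G x.
Hypothesis symH : forall x, V x -> (H x)^T = H x.
Hypothesis unitG : forall x, U x -> G x \in unitmx.
Hypothesis unitH : forall x, V x -> H x \in unitmx.
Hypothesis unitJ : forall x, U x -> 'J phi x \in unitmx.
Hypothesis pullback : forall x, U x ->
  G x = 'J phi x *m H (phi x) *m ('J phi x)^T.
Implicit Types u v w z x : 'rV[R]_4.

Lemma pushforwardE x v : U x -> 'D_v phi x = v *m 'J phi x.
Proof. by move=> Ux; apply: deriveEjacobian; exact: smooth_mx_differentiable Ux. Qed.

Lemma inner_pushforward x v w : U x ->
  inner (G x) v w = inner (H (phi x)) ('D_v phi x) ('D_w phi x).
Proof. by move=> Ux; rewrite pullback// inner_pullback !pushforwardE. Qed.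

Let dF v x u : U x -> derivable ('D_v phi) x u.
Proof. by move=> Ux; exact: smooth_mx_derivable (smooth_mx_derive Uopen _ smooth_phi) Ux. Qed.

Lemma derive_pullback x u v w : U x ->
  inner ('D_u G x) v w =
  inner ('D_('D_u phi x) H (phi x)) ('D_v phi x) ('D_w phi x)
  + inner (H (phi x)) ('D_u ('D_v phi) x) ('D_w phi x)
  + inner (H (phi x)) ('D_v phi x) ('D_u ('D_w phi) x).
Proof.
move=> Ux; have [dH eH] := derive_mx_comp smooth_phi phiUV u smoothH Ux.
rewrite -eH -(derive_inner dH (@dF v x u Ux) (@dF w x u Ux)).
have dcst (c : 'rV[R]_4) : derivable (cst c : 'rV[R]_4 -> 'rV[R]_4) x u.
  exact: derivable_cst.
have dG : derivable G x u by exact: smooth_mx_derivable smoothG Ux.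
have -> : inner ('D_u G x) v w = 'D_u (fun y => inner (G y) v w) x.
  by rewrite (derive_inner dG (dcst v) (dcst w)) !derive_cst inner0l inner0r !addr0.
by apply: (derive_eq_on Uopen) Ux => y Uy; exact: inner_pushforward.
Qed.

(** The defect of tensoriality of the connection is the second derivative of the
    change of coordinates.  Both sides are compared through their Koszul
    formulas. *)
Lemma connection_pushforward x v w : U x ->
  connection G x v w *m 'J phi x =
  'D_v ('D_w phi) x + connection H (phi x) ('D_v phi x) ('D_w phi x).
Proof.
move=> Ux; have Vx := phiUV Ux.
apply: inner_nondeg (unitH Vx) _ => z.
rewrite -[z](mulmxKV (unitJ Ux)); set z' := z *m _.
rewrite -pushforwardE// -[z' *m _]pushforwardE// -inner_pushforward//.
rewrite innerDl (inner_connection Uopen smoothG symG unitG)//.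
rewrite (inner_connection Vopen smoothH symH unitH)// addrC.
apply: (koszul_form_pullback (F := fun u => 'D_u phi x)
          (S := fun a b => 'D_a ('D_b phi) x) (symH Vx)) => [a b|a b c].
  exact: derive_mx_comm smooth_phi Ux.
exact: derive_pullback.
Qed.

Let smoothJ : smooth_mx U (fun y => 'J phi y).
Proof.
move=> i j; have sD := smooth_mx_derive Uopen (delta_mx 0 i) smooth_phi.
apply: smooth_on_ext (sD 0 j) => // y Uy.
by rewrite (pushforwardE _ Uy) -rowE mxE.
Qed.

Let mul_deriveJ x u c : U x ->
  c *m 'D_u (fun y => 'J phi y) x = 'D_u ('D_c phi) x.
Proof.
move=> Ux; have dJ : derivable (fun y => 'J phi y) x u.
  exact: smooth_mx_derivable smoothJ Ux.
have dc : derivable (cst c : 'rV[R]_4 -> 'rV[R]_4) x u by exact: derivable_cst.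
have [_] := derive_mulmx dc dJ; rewrite derive_cst mul0mx add0r => <-.
by apply: (derive_eq_on Uopen) Ux => y Uy; rewrite pushforwardE.
Qed.

(** The Leibniz and chain rules for the connection along [phi]: its Christoffel
    matrices, and each of its two arguments, vary with the point. *)
Let derive_connection_comp x u v w : U x ->
  derivable (fun y => connection H (phi y) ('D_v phi y) ('D_w phi y)) x u /\
  'D_u (fun y => connection H (phi y) ('D_v phi y) ('D_w phi y)) x =
  'D_('D_u phi x) (fun y => connection H y ('D_v phi x) ('D_w phi x)) (phi x)
  + connection H (phi x) ('D_u ('D_v phi) x) ('D_w phi x)
  + connection H (phi x) ('D_v phi x) ('D_u ('D_w phi) x).
Proof.
move=> Ux; have Vx := phiUV Ux.
have iL k : is_derive x u
    (fun y => connection H (phi y) ('D_v phi y) ('D_w phi y) 0 k)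
    (inner ('D_('D_u phi x) (christoffel_mx H k) (phi x)) ('D_v phi x) ('D_w phi x)
     + inner (christoffel_mx H k (phi x)) ('D_u ('D_v phi) x) ('D_w phi x)
     + inner (christoffel_mx H k (phi x)) ('D_v phi x) ('D_u ('D_w phi) x)).
  have sM := smooth_christoffel_mx Vopen smoothH symH unitH k.
  have [dM <-] := derive_mx_comp smooth_phi phiUV u sM Ux.
  have -> : (fun y => connection H (phi y) ('D_v phi y) ('D_w phi y) 0 k) =
      (fun y => inner ((christoffel_mx H k \o phi) y) ('D_v phi y) ('D_w phi y)).
    by apply/funext => y; rewrite mxE.
  exact: is_derive_inner dM (@dF v x u Ux) (@dF w x u Ux).
have dL : derivable (fun y => connection H (phi y) ('D_v phi y) ('D_w phi y)) x u.
  by apply/derivable_mxP => i k; rewrite (ord1 i); have [] := iL k.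
have dR : derivable (fun y => connection H y ('D_v phi x) ('D_w phi x)) (phi x) ('D_u phi x).
  exact: smooth_mx_derivable (smooth_connection Vopen smoothH symH unitH _ _) Vx.
split; first exact: dL.
apply/rowP => k; rewrite (derive_mx dL) mxE (@derive_val _ _ _ _ _ _ _ (iL k)).
rewrite mxE [X in _ = X + _]mxE [X in _ = _ + X + _]mxE (derive_mx dR) mxE.
rewrite [X in _ = _ + X]mxE; congr (_ + _ + _).
have dcst (c : 'rV[R]_4) : derivable (cst c : 'rV[R]_4 -> 'rV[R]_4) (phi x) ('D_u phi x).
  exact: derivable_cst.
have dM : derivable (christoffel_mx H k) (phi x) ('D_u phi x).
  exact: smooth_mx_derivable (smooth_christoffel_mx Vopen smoothH symH unitH k) Vx.
have -> : (fun y => connection H y ('D_v phi x) ('D_w phi x) 0 k) =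
    (fun y => inner (christoffel_mx H k y) ('D_v phi x) ('D_w phi x)).
  by apply/funext => y; rewrite mxE.
rewrite (derive_inner dM (dcst ('D_v phi x)) (dcst ('D_w phi x))) !derive_cst.
by rewrite inner0r inner0l !addr0.
Qed.

(** Differentiating [connection_pushforward] once more produces second and third
    derivatives of [phi]; all of them are symmetric in [u] and [v] and cancel in the
    curvature. *)
Lemma curv_pushforward x u v w : U x ->
  curv G x u v w *m 'J phi x =
  curv H (phi x) ('D_u phi x) ('D_v phi x) ('D_w phi x).
Proof.
move=> Ux; have Vx := phiUV Ux.
have combine (X Y S P1 P2 T Q W : 'rV[R]_4) : S + (T + P1 + P2) = X + Y ->
    X + (Y + (Q + W)) = S + (P1 + (P2 + Q)) + (T + W).
  by move=> e; rewrite addrA -e; apply/rowP => k; rewrite !mxE; ring.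
have half a b :
    ('D_a (fun y => connection G y b w) x + connection G x a (connection G x b w))
      *m 'J phi x =
    'D_a ('D_b ('D_w phi)) x
    + (connection H (phi x) ('D_a ('D_b phi) x) ('D_w phi x)
       + (connection H (phi x) ('D_b phi x) ('D_a ('D_w phi) x)
          + connection H (phi x) ('D_a phi x) ('D_b ('D_w phi) x)))
    + ('D_('D_a phi x) (fun y => connection H y ('D_b phi x) ('D_w phi x)) (phi x)
       + connection H (phi x) ('D_a phi x)
           (connection H (phi x) ('D_b phi x) ('D_w phi x))).
  set c := connection G x b w.
  have dJ : derivable (fun y => 'J phi y) x a by exact: smooth_mx_derivable smoothJ Ux.
  have dC : derivable (fun y => connection G y b w) x a.
    exact: smooth_mx_derivable (smooth_connection Uopen smoothG symG unitG _ _) Ux.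
  have [_ e1] := derive_mulmx dC dJ; rewrite (mul_deriveJ _ _ Ux) in e1.
  have e2 : 'D_a (fun y => connection G y b w *m 'J phi y) x =
      'D_a ('D_b ('D_w phi)) x
      + 'D_a (fun y => connection H (phi y) ('D_b phi y) ('D_w phi y)) x.
    rewrite -deriveD; last 2 first.
    - exact: smooth_mx_derivable (smooth_mx_derive Uopen b (smooth_mx_derive Uopen w smooth_phi)) Ux.
    - exact: (derive_connection_comp _ _ _ Ux).1.
    by apply: (derive_eq_on Uopen) Ux => y Uy; rewrite connection_pushforward.
  rewrite mulmxDl connection_pushforward//.
  have -> : 'D_c phi x = 'D_b ('D_w phi) x + connection H (phi x) ('D_b phi x) ('D_w phi x).
    by rewrite pushforwardE// connection_pushforward.
  rewrite connection_addr.
  have e3 := congr1 (+%R ('D_a ('D_b ('D_w phi)) x)) (derive_connection_comp a b w Ux).2.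
  exact: combine (etrans (esym (etrans e2 e3)) e1).
have c2 : 'D_u ('D_v phi) x = 'D_v ('D_u phi) x.
  exact: derive_mx_comm smooth_phi Ux.
have c3 : 'D_u ('D_v ('D_w phi)) x = 'D_v ('D_u ('D_w phi)) x.
  exact: derive_mx_comm (smooth_mx_derive Uopen w smooth_phi) Ux.
have cancel_sym (S S' A A' B C T T' : 'rV[R]_4) : S = S' -> A = A' ->
    S + (A + (B + C)) + T - (S' + (A' + (C + B)) + T') = T - T'.
  by move=> -> ->; rewrite (addrC C) opprD addrACA subrr add0r.
rewrite /curv mulmxBl.
apply: etrans (congr2 (fun p q => p - q) (half u v) (half v u)) _.
exact: cancel_sym c3 (congr1 (fun s => connection H (phi x) s ('D_w phi x)) c2).
Qed.

Lemma riemann_pushforward x u v w z : U x ->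
  riemann G x u v w z =
  riemann H (phi x) (u *m 'J phi x) (v *m 'J phi x) (w *m 'J phi x) (z *m 'J phi x).
Proof.
move=> Ux; rewrite !riemann_curv pullback// inner_pullback curv_pushforward//.
by rewrite !pushforwardE.
Qed.

End Naturality.

(** * Bivectors *)

Lemma big_ord4 (V : nmodType) (F : 'I_4 -> V) :
  \sum_i F i = F (inord 0) + F (inord 1) + F (inord 2) + F (inord 3).
Proof.
rewrite !big_ord_recl big_ord0 addr0 !addrA.
by congr (F _ + F _ + F _ + F _); apply: val_inj; rewrite /= inordK.
Qed.

Section Bivectors.
Variable R : realType.
Implicit Types (m A B P E : 'M[R]_4) (u v w x y : 'rV[R]_4) (a : R).

Lemma inner2_scalar_l m B : scalar (inner2 m ^~ B).
Proof.
move=> a A A'; rewrite /inner2 mulrCA -mulrDr; congr (_ * _).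
do 4! (rewrite big_distrr -?big_split /=; apply: eq_bigr => ? _).
by rewrite !mxE; ring.
Qed.

Lemma inner2_scalar_r m A : scalar (inner2 m A).
Proof.
move=> a B B'; rewrite /inner2 mulrCA -mulrDr; congr (_ * _).
do 4! (rewrite big_distrr -?big_split /=; apply: eq_bigr => ? _).
by rewrite !mxE; ring.
Qed.

Lemma wedge22_scalar_l B : scalar (@wedge22 R ^~ B).
Proof.
move=> a A A'; rewrite /wedge22 mulrCA -mulrDr; congr (_ * _).
rewrite big_distrr -?big_split /=; apply: eq_bigr => s _.
by rewrite !mxE; move: ((-1) ^+ _ : R) => e; ring.
Qed.

Lemma wedge22_scalar_r A : scalar (@wedge22 R A).
Proof.
move=> a B B'; rewrite /wedge22 mulrCA -mulrDr; congr (_ * _).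
rewrite big_distrr -?big_split /=; apply: eq_bigr => s _.
by rewrite !mxE; move: ((-1) ^+ _ : R) => e; ring.
Qed.

Lemma wedge2E v w (i j : 'I_4) :
  wedge2 v w i j = v 0 i * w 0 j - w 0 i * v 0 j.
Proof. by rewrite !mxE !big_ord1 !mxE. Qed.

Lemma wedge2C v w : wedge2 v w = - wedge2 w v.
Proof. by rewrite /wedge2 opprB. Qed.

Lemma wedge2_linear_r v a w x : wedge2 v (a *: w + x) = a *: wedge2 v w + wedge2 v x.
Proof.
rewrite /wedge2.
have -> : (a *: w + x)^T = a *: w^T + x^T by apply/matrixP => i j; rewrite !mxE.
rewrite mulmxDl mulmxDr -scalemxAr -scalemxAl.
by rewrite scalerBr opprD addrACA.
Qed.

(** In the basis formed by the rows of [E] a bivector has a skew matrix [c], and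
    reads E^T c E. *)
Lemma bivector_frame E A : E \in unitmx -> bivector A ->
  exists c : 'M[R]_4, let w i j := c (inord i) (inord j) *:
      wedge2 (row (inord i) E) (row (inord j) E) in
    A = w 0%N 1%N + w 0%N 2%N + w 0%N 3%N + w 2%N 3%N + w 1%N 3%N + w 1%N 2%N.
Proof.
move=> uE bA; set c := (invmx E)^T *m A *m invmx E; exists c.
have skew : c^T = - c.
  by rewrite /c !trmx_mul trmxK bA mulmxA mulmxN mulNmx.
have cE i j : c j i = - c i j.
  by have /matrixP/(_ i j) := skew; rewrite mxE [in X in _ = X]mxE.
have cii i : c i i = 0 by have := cE i i; lra.
have -> : A = E^T *m c *m E.
  by rewrite /c !mulmxA trmx_inv mulmxV ?unitmx_tr// mul1mx -mulmxA mulVmx// mulmx1.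
move: {bA skew} c cE cii => c cE cii.
apply/matrixP => p q; rewrite mxE big_ord4 ![(E^T *m c) _ _]mxE !big_ord4.
rewrite !cii (cE (inord 0) (inord 1)) (cE (inord 0) (inord 2)) (cE (inord 0) (inord 3)).
rewrite (cE (inord 1) (inord 2)) (cE (inord 1) (inord 3)) (cE (inord 2) (inord 3)).
have addE (X Y : 'M[R]_4) : (X + Y) p q = X p q + Y p q by rewrite mxE.
have scaleE (k : R) (X : 'M[R]_4) : (k *: X) p q = k * X p q by rewrite mxE.
rewrite !addE !scaleE !wedge2E ![row _ _ _ _]mxE ![E^T _ _]mxE.
by ring.
Qed.

(** Decomposable bivectors span all bivectors. *)
Lemma bivector_ind (P : 'M[R]_4 -> Prop) :
  (forall a A B, P A -> P B -> P (a *: A + B)) ->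
  (forall v w, P (wedge2 v w)) -> forall A, bivector A -> P A.
Proof.
move=> Plin Pw A bA; have [c ->] := bivector_frame (unitmx1 _ _) bA.
have P0 : P 0 by rewrite -(subrr (wedge2 0 0)) addrC -scaleN1r; exact: Plin.
have PZ a B : P B -> P (a *: B) by move=> PB; rewrite -[X in P X]addr0; exact: Plin.
have PD B C : P B -> P C -> P (B + C) by move=> PB PC; rewrite -[B]scale1r; exact: Plin.
by do 5! (apply: (PD); last exact: PZ); exact: PZ.
Qed.

(** This turns the equation that defines the curvature operator into a matrix
    equation, solved by inverting [m]. *)
Lemma inner2_wedge2r m A x y : bivector A ->
  inner2 m A (wedge2 x y) = inner (m^T *m A *m m) x y.
Proof.
move: A; apply: bivector_ind => [a A A' eA eA'|v w].
  rewrite inner2_scalar_l eA eA' mulmxDr mulmxDl innerDm -scalemxAr -scalemxAl.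
  by rewrite innerZm.
have E (p q : 'rV[R]_4) :
    inner (m^T *m (p^T *m q) *m m) x y = inner m p x * inner m q y.
  have -> : inner (m^T *m (p^T *m q) *m m) x y =
      ((p *m m *m x^T)^T *m (q *m m *m y^T)) 0 0.
    by rewrite /inner !trmx_mul trmxK !mulmxA.
  by rewrite mxE big_ord1 mxE.
rewrite inner2_wedge2 /wedge2 mulmxBr mulmxBl innerDm -[- (_ *m m)]scaleN1r innerZm !E.
by ring.
Qed.

Let rows4 v w x y : 'M[R]_4 := \matrix_(i < 4) nth 0 [:: v; w; x; y] i.

Let wedge22_rows v w x y :
  wedge22 (wedge2 v w) (wedge2 x y) = \det (rows4 v w x y).
Proof. by rewrite -wedge22_wedge2 /rows4 !rowK !inordK. Qed.

(** A determinant with a repeated row. *)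
Lemma wedge22_common v w y : wedge22 (wedge2 v w) (wedge2 v y) = 0.
Proof.
rewrite wedge22_rows; apply: (@determinant_alternate _ _ _ (inord 0) (inord 2)).
  by rewrite -val_eqE /= !inordK.
by move=> j; rewrite !mxE !inordK.
Qed.

Lemma wedge22Nl A B : wedge22 (- A) B = - wedge22 A B.
Proof. exact: (scalar_formN (wedge22_scalar_l B)). Qed.

Lemma wedge22Nr A B : wedge22 A (- B) = - wedge22 A B.
Proof. exact: (scalar_formN (wedge22_scalar_r A)). Qed.

Lemma wedge22_common_mid v w y : wedge22 (wedge2 v w) (wedge2 w y) = 0.
Proof. by rewrite wedge2C wedge22Nl wedge22_common oppr0. Qed.

(** Polarization of [wedge22_common_mid] in the common vector. *)
Lemma wedge22_swap v w x y :
  wedge22 (wedge2 v x) (wedge2 w y) = - wedge22 (wedge2 v w) (wedge2 x y).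
Proof.
have := wedge22_common_mid v (1 *: w + x) y.
have wedge2_linear_l a p q r : wedge2 (a *: p + q) r = a *: wedge2 p r + wedge2 q r.
  by rewrite wedge2C wedge2_linear_r opprD -scalerN -!wedge2C.
rewrite wedge2_linear_r wedge22_scalar_l wedge2_linear_l !wedge22_scalar_r.
by rewrite !wedge22_common_mid; lra.
Qed.

End Bivectors.

(** * Curvature operator and trace at a point *)

Section CurvatureLike.
Variables (R : realType) (T : tensor4 R).
Hypothesis T_like : curvature_like T.
Implicit Types u v w x y z : 'rV[R]_4.

Lemma curvature_like_anti12 u v w z : T v u w z = - T u v w z.
Proof. by have [_ + _] := T_like; exact. Qed.

Lemma curvature_like_pair u v w z : T w z u v = T u v w z.
Proof. by have [_ _] := T_like; exact. Qed.

Lemma curvature_like_anti34 u v w z : T u v z w = - T u v w z.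
Proof. by rewrite -!(curvature_like_pair u v) curvature_like_anti12. Qed.

Lemma curvature_like_lin1 v w z : scalar (fun u => T u v w z).
Proof. by have [+ _ _] := T_like; exact. Qed.

Lemma curvature_like_lin2 u w z : scalar (fun v => T u v w z).
Proof.
move=> a v v'; rewrite 3!(curvature_like_anti12 _ u) curvature_like_lin1; ring.
Qed.

Lemma curvature_like_lin3 u v z : scalar (fun w => T u v w z).
Proof.
by move=> a w w'; rewrite -3!(curvature_like_pair u v) curvature_like_lin1.
Qed.

Lemma curvature_like_lin4 u v w : scalar (T u v w).
Proof.
by move=> a z z'; rewrite -3!(curvature_like_pair u v) curvature_like_lin2.
Qed.

End CurvatureLike.

Section CurvatureOperator.
Variables (R : realType) (g : 'M[R]_4) (T : tensor4 R).
Hypotheses (gsym : g^T = g) (gunit : g \in unitmx) (T_like : curvature_like T).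

(** The curvature operator with its values lowered by [g]; the factor 1/2 corrects
    for counting each pair of indices twice. *)
Let tau (A : 'M[R]_4) : 'M[R]_4 := \matrix_(c, d) (- 2^-1 * \sum_a \sum_b
  A a b * T (delta_mx 0 a) (delta_mx 0 b) (delta_mx 0 c) (delta_mx 0 d)).

Let tau_linear : linear tau.
Proof.
move=> k A B; apply/matrixP => c d; rewrite !mxE mulrCA -mulrDr; congr (_ * _).
do 2! (rewrite big_distrr -?big_split /=; apply: eq_bigr => ? _).
by rewrite !mxE; ring.
Qed.

Let tau_wedge2 v w x y : inner (tau (wedge2 v w)) x y = - T v w x y.
Proof.
have l1 := curvature_like_lin1 T_like; have l2 := curvature_like_lin2 T_like.
have l3 := curvature_like_lin3 T_like; have l4 := curvature_like_lin4 T_like.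
apply: (@bilinear_delta _ (inner (tau (wedge2 v w))) (fun x y => - T v w x y)).
- exact: inner_scalar_l.
- exact: inner_scalar_r.
- by move=> z a p q; rewrite l3; ring.
- by move=> z a p q; rewrite l4; ring.
move=> c d; rewrite inner_delta mxE.
have sumE (p q : 'rV[R]_4) : \sum_a \sum_b p 0 a * q 0 b *
      T (delta_mx 0 a) (delta_mx 0 b) (delta_mx 0 c) (delta_mx 0 d) =
    T p q (delta_mx 0 c) (delta_mx 0 d).
  rewrite [in RHS](row_sum_delta p) (scalar_sum (l1 _ _ _)).
  apply: eq_bigr => a _; rewrite [in RHS](row_sum_delta q) (scalar_sum (l2 _ _ _)).
  by rewrite big_distrr /=; apply: eq_bigr => b _; rewrite mulrA.
have -> : \sum_a \sum_b wedge2 v w a b *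
    T (delta_mx 0 a) (delta_mx 0 b) (delta_mx 0 c) (delta_mx 0 d) =
    T v w (delta_mx 0 c) (delta_mx 0 d) - T w v (delta_mx 0 c) (delta_mx 0 d).
  rewrite -!sumE -sumrB; apply: eq_bigr => a _; rewrite -sumrB.
  by apply: eq_bigr => b _; rewrite wedge2E mulrBl.
by rewrite (curvature_like_anti12 T_like v w); field.
Qed.

(** An operator with the required property exists, by raising the indices of [tau]
    with the inverse metric, so the chosen one has it as well. *)
Lemma curvature_operatorP : is_curvature_operator g T (curvature_operator g T).
Proof.
rewrite /curvature_operator.
suff [L PL] : exists L, is_curvature_operator g T L.
  by case: xgetP => [L' _ //|/(_ L)].
exists (fun A => invmx g *m tau A *m invmx g).
have bL A : bivector A -> bivector (invmx g *m tau A *m invmx g).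
  move=> _; rewrite /bivector !trmx_mul trmx_inv gsym mulmxA -mulNmx -mulmxN.
  congr (_ *m _ *m _); apply/matrixP => c d; rewrite !mxE -mulrN; congr (_ * _).
  rewrite -sumrN; apply: eq_bigr => a _; rewrite -sumrN; apply: eq_bigr => b _.
  by rewrite (curvature_like_anti34 T_like) mulrN.
split=> // [k A B|v w x y].
  by rewrite tau_linear mulmxDr mulmxDl -scalemxAr -scalemxAl.
rewrite inner2_wedge2r; last exact/bL/wedge2_bivector.
by rewrite gsym !mulmxA mulmxV// mul1mx mulmxKV// tau_wedge2.
Qed.

End CurvatureOperator.

Section OrthonormalFrame.
Variables (R : realType) (m E : 'M[R]_4).
Hypothesis mE : Defs.orthonormal m E.
Implicit Types (a b : 'I_4).

Definition frame_signs : 'rV[R]_4 := \row_k inner m (row k E) (row k E).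

Lemma congruence_entry (F : 'M[R]_4) a b :
  (E *m F *m E^T) a b = inner F (row a E) (row b E).
Proof.
rewrite /inner -row_mul [LHS]mxE [RHS]mxE.
by apply: eq_bigr => k _; rewrite !mxE.
Qed.

Lemma frame_diagonal : E *m m *m E^T = diag_mx frame_signs.
Proof.
apply/matrixP => a b; rewrite congruence_entry !mxE.
by have [->|/(mE a b).1->] := eqVneq a b.
Qed.

Lemma frame_signs_sqr k : frame_signs 0 k * frame_signs 0 k = 1.
Proof.
have [_] := mE k k; rewrite mxE.
case: (ler0P (inner m (row k E) (row k E))) => _ e; first by rewrite -mulrNN e mulr1.
by rewrite e mulr1.
Qed.

Lemma frame_signs_norm k : `|frame_signs 0 k| = 1.
Proof. by rewrite mxE; have [] := mE k k. Qed.

Lemma frame_det : \det E ^+ 2 * \det m = \prod_k frame_signs 0 k.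
Proof.
by rewrite -det_diag -frame_diagonal !det_mulmx det_tr expr2 mulrAC.
Qed.

Lemma frame_det_norm : `|\det E| ^+ 2 * `|\det m| = 1.
Proof.
rewrite -normrX -normrM frame_det normr_prod big1// => k _.
exact: frame_signs_norm.
Qed.

Lemma frame_unit : E \in unitmx.
Proof.
rewrite unitmxE unitfE; apply/eqP => e; have := frame_det_norm.
by rewrite e normr0 expr2 !mul0r => /eqP; rewrite eq_sym oner_eq0.
Qed.

Lemma frame_form_unit : m \in unitmx.
Proof.
rewrite unitmxE unitfE; apply/eqP => e; have := frame_det_norm.
by rewrite e normr0 mulr0 => /eqP; rewrite eq_sym oner_eq0.
Qed.

(** The Gram matrix in an orthonormal frame is its own inverse. *)
Lemma frame_invmx : invmx m = E^T *m diag_mx frame_signs *m E.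
Proof.
have DD : diag_mx frame_signs *m diag_mx frame_signs = 1%:M.
  rewrite mulmx_diag -diag_const_mx; congr diag_mx.
  by apply/rowP => k; rewrite mxE frame_signs_sqr mxE.
have uE := frame_unit.
have inv : m *m (E^T *m diag_mx frame_signs *m E) = 1%:M.
  apply: (can_inj (mulKmx uE)); rewrite mulmx1 !mulmxA frame_diagonal DD.
  by rewrite mul1mx.
by rewrite -[RHS](mulKmx frame_form_unit) inv mulmx1.
Qed.

Lemma frame_trace (F : 'M[R]_4) :
  \sum_k frame_signs 0 k * inner F (row k E) (row k E) = \tr (invmx m *m F).
Proof.
rewrite frame_invmx -mulmxA -mulmxA mxtrace_mulC.
apply: eq_bigr => k _; rewrite -!mulmxA mul_diag_mx [RHS]mxE; congr (_ * _).
by rewrite mulmxA congruence_entry.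
Qed.

End OrthonormalFrame.

Lemma inner_tensor14 (R : realType) (T : tensor4 R) x y v w :
  curvature_like T ->
  inner (\matrix_(c, d) T (delta_mx 0 c) x y (delta_mx 0 d)) v w = T v x y w.
Proof.
move=> T_like.
apply: (@bilinear_delta _ (inner (\matrix_(c, d) T (delta_mx 0 c) x y (delta_mx 0 d)))
  (fun v w => T v x y w)) => [z|z|z|z|i j].
- exact: inner_scalar_l.
- exact: inner_scalar_r.
- exact: curvature_like_lin1.
- exact: curvature_like_lin4.
by rewrite inner_delta mxE.
Qed.

(** The trace over an orthonormal frame is the contraction with the inverse Gram
    matrix, whatever the frame; so there is a common value to choose. *)
Lemma trace14E (R : realType) (m E : 'M[R]_4) (T : tensor4 R) x y :
  Defs.orthonormal m E -> curvature_like T ->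
  trace14 m T x y =
  \tr (invmx m *m \matrix_(c, d) T (delta_mx 0 c) x y (delta_mx 0 d)).
Proof.
move=> mE T_like; set t := \tr _.
have tE F : Defs.orthonormal m F -> t = \sum_(k < 4) inner m (row k F) (row k F) *
    T (row k F) x y (row k F).
  move=> mF; rewrite /t -(frame_trace mF); apply: eq_bigr => k _.
  by rewrite mxE inner_tensor14.
rewrite /trace14.
case: xgetP => [t' _ /(_ E mE)->|/(_ t)] //.
by rewrite -tE.
Qed.

Lemma trace14_frame (R : realType) (m E : 'M[R]_4) (T : tensor4 R) x y :
  Defs.orthonormal m E -> curvature_like T ->
  trace14 m T x y =
  \sum_k inner m (row k E) (row k E) * T (row k E) x y (row k E).
Proof.
move=> mE T_like; rewrite (trace14E _ _ mE T_like) -(frame_trace mE).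
by apply: eq_bigr => k _; rewrite mxE inner_tensor14.
Qed.

(** * The three conditions in an adapted frame *)

Section WedgeTable.
Variables (R : realType).
Implicit Types (v w x y : 'rV[R]_4).

Lemma wedge22_commonr v w x : wedge22 (wedge2 v w) (wedge2 x v) = 0.
Proof. by rewrite (wedge2C x v) wedge22Nr wedge22_common oppr0. Qed.

Lemma wedge22_commonrr v w x : wedge22 (wedge2 v w) (wedge2 x w) = 0.
Proof. by rewrite (wedge2C x w) wedge22Nr wedge22_common_mid oppr0. Qed.

(** Multi-rule for two wedges with a common vector, in any position. *)
Definition wedge22_shared :=
  (@wedge22_common R, @wedge22_common_mid R, wedge22_commonr, wedge22_commonrr).

Variables (e0 e1 e2 e3 : 'rV[R]_4) (d : R).
Hypothesis vol : wedge22 (wedge2 e0 e1) (wedge2 e2 e3) = d.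

(** All six values follow from [vol] by transposing vectors. *)
Lemma wedge22_frame :
  ((wedge22 (wedge2 e0 e1) (wedge2 e2 e3) = d)
   * (wedge22 (wedge2 e2 e3) (wedge2 e0 e1) = d)
   * (wedge22 (wedge2 e0 e2) (wedge2 e1 e3) = - d)
   * (wedge22 (wedge2 e1 e3) (wedge2 e0 e2) = - d)
   * (wedge22 (wedge2 e0 e3) (wedge2 e1 e2) = d)
   * (wedge22 (wedge2 e1 e2) (wedge2 e0 e3) = d))%type.
Proof.
have sw v w x y : wedge22 (wedge2 v x) (wedge2 w y) = - wedge22 (wedge2 v w) (wedge2 x y).
  exact: wedge22_swap.
have fl v w x y : wedge22 (wedge2 w v) (wedge2 x y) = - wedge22 (wedge2 v w) (wedge2 x y).
  by rewrite wedge2C wedge22Nl.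
have fr v w x y : wedge22 (wedge2 v w) (wedge2 y x) = - wedge22 (wedge2 v w) (wedge2 x y).
  by rewrite (wedge2C y) wedge22Nr.
have q13 : wedge22 (wedge2 e1 e3) (wedge2 e0 e2) = - d.
  by rewrite (sw e1 e0 e3 e2) fl fr vol !opprK.
have q02 : wedge22 (wedge2 e0 e2) (wedge2 e1 e3) = - d by rewrite (sw e0 e1 e2 e3) vol.
have q03 : wedge22 (wedge2 e0 e3) (wedge2 e1 e2) = d.
  by rewrite (sw e0 e1 e3 e2) fr vol opprK.
have q23 : wedge22 (wedge2 e2 e3) (wedge2 e0 e1) = d.
  by rewrite (sw e2 e0 e3 e1) fl fr q02 !opprK.
have q12 : wedge22 (wedge2 e1 e2) (wedge2 e0 e3) = d.
  by rewrite (sw e1 e0 e2 e3) fl vol opprK.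
by [].
Qed.

End WedgeTable.

(** A frame [e] in which [g] is the identity and [h] is diagonal of signature
    (-,-,+,+).  The hypotheses list what the argument extracts from it, so that
    the bivectors [w i j] can be handled as a formal basis. *)
Section AdaptedFrame.
Variables (R : realType) (g h : 'M[R]_4) (e : nat -> 'rV[R]_4) (d : R).
Local Notation w i j := (wedge2 (e i) (e j)).
Implicit Types (A B : 'M[R]_4).

Hypothesis ge : forall i j, (i < 4)%N -> (j < 4)%N ->
  inner g (e i) (e j) = (i == j)%:R.
Hypothesis he : forall i j, (i < 4)%N -> (j < 4)%N ->
  inner h (e i) (e j) = if i == j then (if (i < 2)%N then -1 else 1) else 0.
Hypothesis vec_span : forall x, exists c : nat -> R,
  x = c 0%N *: e 0%N + c 1%N *: e 1%N + c 2%N *: e 2%N + c 3%N *: e 3%N.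
Hypothesis bivector_span : forall A, bivector A -> exists c : nat -> nat -> R,
  A = c 0%N 1%N *: w 0%N 1%N + c 0%N 2%N *: w 0%N 2%N + c 0%N 3%N *: w 0%N 3%N
    + c 2%N 3%N *: w 2%N 3%N + c 1%N 3%N *: w 1%N 3%N + c 1%N 2%N *: w 1%N 2%N.
Hypothesis d_neq0 : d != 0.
Hypothesis vol : wedge22 (w 0%N 1%N) (w 2%N 3%N) = d.

Lemma frame_bivector_ind (P : 'M[R]_4 -> Prop) :
  (forall a A B, P A -> P B -> P (a *: A + B)) ->
  P (w 0 1) -> P (w 0 2) -> P (w 0 3) -> P (w 2 3) -> P (w 1 3) -> P (w 1 2) ->
  forall A, bivector A -> P A.
Proof.
move=> Plin P01 P02 P03 P23 P13 P12 A /bivector_span[c ->].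
have P0 : P 0 by rewrite -(subrr (w 0 1)) addrC -scaleN1r; exact: Plin.
have PZ a B : P B -> P (a *: B) by move=> PB; rewrite -[X in P X]addr0; exact: Plin.
have PD B C : P B -> P C -> P (B + C) by move=> PB PC; rewrite -[B]scale1r; exact: Plin.
by do 5! (apply: (PD); last exact: PZ); exact: PZ.
Qed.

Lemma inner2_frame i j k l : (i < 4)%N -> (j < 4)%N -> (k < 4)%N -> (l < 4)%N ->
  inner2 g (w i j) (w k l) = (i == k)%:R * (j == l)%:R - (i == l)%:R * (j == k)%:R.
Proof. by move=> i4 j4 k4 l4; rewrite inner2_wedge2 !ge. Qed.

Lemma inner2_frame_eq A B : bivector A -> bivector B ->
  (forall i j, (i < j < 4)%N -> inner2 g A (w i j) = inner2 g B (w i j)) -> A = B.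
Proof.
have coord C : bivector C -> C = inner2 g C (w 0 1) *: w 0 1
    + inner2 g C (w 0 2) *: w 0 2 + inner2 g C (w 0 3) *: w 0 3
    + inner2 g C (w 2 3) *: w 2 3 + inner2 g C (w 1 3) *: w 1 3
    + inner2 g C (w 1 2) *: w 1 2.
  move=> /bivector_span[c ->]; set C' := (X in X = _).
  have cE i j : (i < 4)%N -> (j < 4)%N -> inner2 g C' (w i j) =
      c 0%N 1%N * inner2 g (w 0 1) (w i j) + c 0%N 2%N * inner2 g (w 0 2) (w i j)
      + c 0%N 3%N * inner2 g (w 0 3) (w i j) + c 2%N 3%N * inner2 g (w 2 3) (w i j)
      + c 1%N 3%N * inner2 g (w 1 3) (w i j) + c 1%N 2%N * inner2 g (w 1 2) (w i j).
    by move=> _ _; exact: (scalar_form6 (inner2_scalar_l g (w i j))).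
  have [c1 c2 c3] : [/\ inner2 g C' (w 0 1) = c 0%N 1%N, inner2 g C' (w 0 2) = c 0%N 2%N
      & inner2 g C' (w 0 3) = c 0%N 3%N].
    by split; rewrite cE// !inner2_frame//=; ring.
  have [c4 c5 c6] : [/\ inner2 g C' (w 2 3) = c 2%N 3%N, inner2 g C' (w 1 3) = c 1%N 3%N
      & inner2 g C' (w 1 2) = c 1%N 2%N].
    by split; rewrite cE// !inner2_frame//=; ring.
  by rewrite c1 c2 c3 c4 c5 c6.
move=> bA bB AB; rewrite (coord A bA) (coord B bB).
by rewrite !AB.
Qed.

(** Pairing with the six frame bivectors dictates the coefficients of S B. *)
Lemma star_exists : exists S : 'M[R]_4 -> 'M[R]_4,
  [/\ linear S, forall A, bivector (S A) &
    forall A B, bivector A -> wedge22 A (S B) = inner2 h A B * d].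
Proof.
pose S B := inner2 h (w 2 3) B *: w 0 1 + (- inner2 h (w 1 3) B) *: w 0 2
  + inner2 h (w 1 2) B *: w 0 3 + inner2 h (w 0 1) B *: w 2 3
  + (- inner2 h (w 0 2) B) *: w 1 3 + inner2 h (w 0 3) B *: w 1 2.
exists S; split.
- move=> a A B; rewrite /S !inner2_scalar_r; apply/matrixP => i j.
  by rewrite !mxE; ring.
- move=> A; have b i j : bivector (w i j) by exact: wedge2_bivector.
  rewrite /S; have bZ a X : bivector X -> bivector (a *: X).
    by rewrite /bivector => bX; rewrite linearZ /= bX scalerN.
  have bD X Y : bivector X -> bivector Y -> bivector (X + Y).
    by rewrite /bivector => bX bY; rewrite linearD /= bX bY opprD.
  by do 5! (apply: (bD); last exact: bZ); exact: bZ.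
move=> A B; move: A.
apply: frame_bivector_ind => [a X Y eX eY||||||].
  by rewrite wedge22_scalar_l inner2_scalar_l eX eY; ring.
all: rewrite (scalar_form6 (wedge22_scalar_r _)) !(wedge22_shared, wedge22_frame vol).
all: by ring.
Qed.

Section Star.
Variable S : 'M[R]_4 -> 'M[R]_4.
Hypotheses (S_linear : linear S) (S_biv : forall A, bivector A -> bivector (S A)).
Hypothesis S_star : forall A B, bivector A -> bivector B ->
  wedge22 A (S B) = inner2 h A B * d.

(** The coefficients of S B are again found by pairing; the signs are those of [h]
    and of the permutations of the frame. *)
Lemma star_frame :
  ((S (w 0 1) = w 2 3) * (S (w 2 3) = w 0 1)
   * (S (w 0 2) = w 1 3) * (S (w 1 3) = w 0 2)
   * (S (w 0 3) = - w 1 2) * (S (w 1 2) = - w 0 3))%type.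
Proof.
have biv v x := wedge2_bivector v x.
have expand B : bivector B -> S B =
     inner2 h (w 2 3) B *: w 0 1 - inner2 h (w 1 3) B *: w 0 2
     + inner2 h (w 1 2) B *: w 0 3 + inner2 h (w 0 1) B *: w 2 3
     - inner2 h (w 0 2) B *: w 1 3 + inner2 h (w 0 3) B *: w 1 2.
  move=> bB; have [c SE] := bivector_span (S_biv bB).
  have cE i j : inner2 h (w i j) B * d =
      c 0%N 1%N * wedge22 (w i j) (w 0 1) + c 0%N 2%N * wedge22 (w i j) (w 0 2)
      + c 0%N 3%N * wedge22 (w i j) (w 0 3) + c 2%N 3%N * wedge22 (w i j) (w 2 3)
      + c 1%N 3%N * wedge22 (w i j) (w 1 3) + c 1%N 2%N * wedge22 (w i j) (w 1 2).
    by rewrite -S_star// SE; exact: (scalar_form6 (wedge22_scalar_r (w i j))).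
  have [h1 h2 h3] : [/\ inner2 h (w 2 3) B = c 0%N 1%N, inner2 h (w 1 3) B = - c 0%N 2%N
      & inner2 h (w 1 2) B = c 0%N 3%N].
    by split; apply: (mulIf d_neq0);
      rewrite cE !(wedge22_shared, wedge22_frame vol); ring.
  have [h4 h5 h6] : [/\ inner2 h (w 0 1) B = c 2%N 3%N, inner2 h (w 0 2) B = - c 1%N 3%N
      & inner2 h (w 0 3) B = c 1%N 2%N].
    by split; apply: (mulIf d_neq0);
      rewrite cE !(wedge22_shared, wedge22_frame vol); ring.
  by rewrite SE h1 h2 h3 h4 h5 h6 !scaleNr !opprK.
have hw i j k l : (i < 4)%N -> (j < 4)%N -> (k < 4)%N -> (l < 4)%N ->
    inner2 h (w i j) (w k l) =
    inner h (e i) (e k) * inner h (e j) (e l) - inner h (e i) (e l) * inner h (e j) (e k).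
  by move=> *; rewrite inner2_wedge2.
by do ![split]; rewrite expand// !hw// !he//= !(mulr0, mul0r, mulr1, mulrN1, opprK, subr0, oppr0);
  rewrite !(scale0r, scale1r, scaleN1r, add0r, addr0, subr0, oppr0, opprK).
Qed.

Let inner2D A B C : inner2 g (A + B) C = inner2 g A C + inner2 g B C.
Proof. exact: (scalar_formD (inner2_scalar_l g C)). Qed.

Let inner2Nl A C : inner2 g (- A) C = - inner2 g A C.
Proof. exact: (scalar_formN (inner2_scalar_l g C)). Qed.

Let inner2Nr A C : inner2 g A (- C) = - inner2 g A C.
Proof. exact: (scalar_formN (inner2_scalar_r g A)). Qed.

(** The star permutes, up to sign, a basis of bivectors that is orthonormal for [g];
    this is where sharing a frame matters. *)
Lemma star_isometry A B : bivector A -> bivector B ->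
  inner2 g (S A) (S B) = inner2 g A B.
Proof.
move: A; apply: (@frame_bivector_ind (fun A => bivector B ->
    inner2 g (S A) (S B) = inner2 g A B)) => [a A A' eA eA' bB|bB|bB|bB|bB|bB|bB].
  by rewrite S_linear !inner2_scalar_l eA// eA'.
all: move: B bB; apply: frame_bivector_ind => [a B B' eB eB'||||||];
  first by rewrite S_linear !inner2_scalar_r eB eB'.
all: rewrite !star_frame ?inner2Nl ?inner2Nr !inner2_frame//=.
all: by ring.
Qed.

Lemma starK A : bivector A -> S (S A) = A.
Proof.
have SN := linear_mapN S_linear.
move: A; apply: frame_bivector_ind => [a A B eA eB||||||].
  by rewrite !S_linear eA eB.
all: by rewrite !star_frame ?SN ?star_frame ?opprK.
Qed.

Section CurvatureConditions.
Variables (T : tensor4 R) (L : 'M[R]_4 -> 'M[R]_4).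
Hypothesis T_like : curvature_like T.
Hypotheses (L_linear : linear L) (L_biv : forall A, bivector A -> bivector (L A)).
Hypothesis L_curv : forall v x y z,
  inner2 g (L (wedge2 v x)) (wedge2 y z) = - T v x y z.
Local Notation t i j k l := (T (e i) (e j) (e k) (e l)).

(** Invariance under the star of the symmetric 6 by 6 matrix of curvature
    components. *)
Definition star_invariant_components : Prop :=
  [/\ t 0 1 0 1 = t 2 3 2 3, t 0 2 0 2 = t 1 3 1 3, t 0 3 0 3 = t 1 2 1 2 &
   [/\ t 0 1 0 2 = t 2 3 1 3, t 0 1 1 3 = t 2 3 0 2, t 0 1 0 3 = - t 2 3 1 2 &
   [/\ t 0 1 1 2 = - t 2 3 0 3, t 0 2 0 3 = - t 1 3 1 2 & t 0 2 1 2 = - t 1 3 0 3]]].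

Let K_frame i j k l : inner2 g (L (w i j)) (w k l) = - t i j k l.
Proof. exact: L_curv. Qed.

Let LN A : L (- A) = - L A.
Proof. exact: (linear_mapN L_linear). Qed.

Let pair i j k l : t i j k l = t k l i j.
Proof. exact: curvature_like_pair. Qed.

(** An isometric involution is self-adjoint. *)
Let star_adjoint A B : bivector A -> bivector B ->
  inner2 g (S A) B = inner2 g A (S B).
Proof. by move=> bA bB; rewrite -{1}(starK bB) star_isometry//; exact: S_biv. Qed.

(** Since S is self-adjoint, commutation says that K(SA,B) = K(A,SB) for the form
    K(A,B) = <LA,B>.  On pairs of frame bivectors these are the nine equations,
    repetitions of them by the symmetry of K, or trivial. *)
Lemma star_commute_components :
  (forall A, bivector A -> L (S A) = S (L A)) <-> star_invariant_components.
Proof.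
have wb i j : bivector (w i j) by exact: wedge2_bivector.
split=> [comm|].
  have key A B : bivector A -> bivector B ->
      inner2 g (L (S A)) B = inner2 g (L A) (S B).
    by move=> bA bB; rewrite comm// star_adjoint//; exact: L_biv.
  have k i j k' l := key (w i j) (w k' l) (wb i j) (wb k' l).
  have := (k 0 1 2 3, k 0 2 1 3, k 0 3 1 2, k 0 1 1 3, k 0 1 0 2, k 0 1 1 2, k 0 1 0 3,
    k 0 2 1 2, k 0 2 0 3)%N.
  rewrite !star_frame !LN !inner2Nl !inner2Nr !K_frame.
  move=> [[[[[[[[k1 k2] k3] k4] k5] k6] k7] k8] k9].
  by do !split; lra.
move=> [e1 e2 e3 [e4 e5 e6 [e7 e8 e9]]].
rewrite (pair 2 3 0 2) in e5; rewrite (pair 2 3 0 3) in e7; rewrite (pair 1 3 0 3) in e9.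
have key A B : bivector A -> bivector B ->
    inner2 g (L (S A)) B = inner2 g (L A) (S B).
{ move: A; apply: (@frame_bivector_ind (fun A => bivector B ->
      inner2 g (L (S A)) B = inner2 g (L A) (S B)))
      => [a A A' eA eA' bB|bB|bB|bB|bB|bB|bB];
    first by rewrite S_linear !L_linear !inner2_scalar_l eA// eA'.
  all: move: B bB; apply: frame_bivector_ind => [a B B' eB eB'||||||];
    first by rewrite S_linear !inner2_scalar_r eB eB'.
  all: rewrite !star_frame ?LN ?inner2Nl ?inner2Nr !K_frame.
  all: rewrite ?(pair 0 2 0 1) ?(pair 0 3 0 1) ?(pair 2 3 0 1) ?(pair 1 3 0 1)
    ?(pair 1 2 0 1) ?(pair 0 3 0 2) ?(pair 2 3 0 2) ?(pair 1 3 0 2) ?(pair 1 2 0 2)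
    ?(pair 2 3 0 3) ?(pair 1 3 0 3) ?(pair 1 2 0 3) ?(pair 1 3 2 3) ?(pair 1 2 2 3)
    ?(pair 1 2 1 3).
  all: by lra.
}
move=> A bA; apply: inner2_frame_eq => [||i j _].
- exact/L_biv/S_biv.
- exact/S_biv/L_biv.
by rewrite key// star_adjoint//; exact: L_biv.
Qed.

Let t_anti12 i j k l : t j i k l = - t i j k l.
Proof. exact: curvature_like_anti12. Qed.

Let t_anti34 i j k l : t i j l k = - t i j k l.
Proof. exact: curvature_like_anti34. Qed.

Let t_diag12 i k l : t i i k l = 0.
Proof. by have := t_anti12 i i k l; lra. Qed.

Let t_diag34 i k l : t k l i i = 0.
Proof. by rewrite pair t_diag12. Qed.

(** Rewriting system towards components [t i j k l] with increasing pairs i j and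
    k l, in the order 01, 02, 03, 23, 13, 12. *)
Let t_sorted := (t_diag12, t_diag34,
  (t_anti12 0 1, t_anti12 0 2, t_anti12 0 3, t_anti12 1 2, t_anti12 1 3, t_anti12 2 3)%N,
  (fun i j => t_anti34 i j 0 1, fun i j => t_anti34 i j 0 2, fun i j => t_anti34 i j 0 3,
   fun i j => t_anti34 i j 1 2, fun i j => t_anti34 i j 1 3, fun i j => t_anti34 i j 2 3)%N,
  (pair 0 2 0 1, pair 0 3 0 1, pair 2 3 0 1, pair 1 3 0 1, pair 1 2 0 1),
  (pair 0 3 0 2, pair 2 3 0 2, pair 1 3 0 2, pair 1 2 0 2),
  (pair 2 3 0 3, pair 1 3 0 3, pair 1 2 0 3, pair 1 3 2 3, pair 1 2 2 3, pair 1 2 1 3)).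

Variable tr : 'rV[R]_4 -> 'rV[R]_4 -> R.
Hypothesis trE : forall x y, tr x y =
  - T (e 0%N) x y (e 0%N) - T (e 1%N) x y (e 1%N)
  + T (e 2%N) x y (e 2%N) + T (e 3%N) x y (e 3%N).

Let frame_bilinear_ext (F G : 'rV[R]_4 -> 'rV[R]_4 -> R) :
  (forall y, scalar (F^~ y)) -> (forall x, scalar (F x)) ->
  (forall y, scalar (G^~ y)) -> (forall x, scalar (G x)) ->
  (forall i j, (i < 4)%N -> (j < 4)%N -> F (e i) (e j) = G (e i) (e j)) ->
  forall x y, F x y = G x y.
Proof.
have comb (f : 'rV[R]_4 -> R) (c : nat -> R) : scalar f ->
    f (c 0%N *: e 0%N + c 1%N *: e 1%N + c 2%N *: e 2%N + c 3%N *: e 3%N) =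
    c 0%N * f (e 0%N) + c 1%N * f (e 1%N) + c 2%N * f (e 2%N) + c 3%N * f (e 3%N).
  by move=> fl; rewrite !(scalar_formD fl) !(scalar_formZ fl).
move=> Fl Fr Gl Gr FG x y.
have [a ->] := vec_span x; have [b ->] := vec_span y.
apply: etrans (comb _ a (Fl _)) _; apply: etrans _ (esym (comb _ a (Gl _))).
by rewrite !(comb _ b (Fr _)) !(comb _ b (Gr _)) !FG.
Qed.

(** The diagonal components give f and three equations, the six others do not
    involve f. *)
Lemma trace_components :
  (exists f, forall x y, tr x y = f * inner h x y) <-> star_invariant_components.
Proof.
split=> [[f trf]|].
  have k i j := trf (e i) (e j).
  have := (k 0 0, k 1 1, k 2 2, k 3 3, k 0 1, k 0 2, k 0 3, k 1 2, k 1 3, k 2 3)%N.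
  rewrite !trE !he//= !t_sorted.
  move=> [[[[[[[[[k0 k1] k2] k3] k4] k5] k6] k7] k8] k9].
  rewrite /star_invariant_components !t_sorted.
  by do !split; lra.
rewrite /star_invariant_components !t_sorted.
move=> [e1 e2 e3 [e4 e5 e6 [e7 e8 e9]]].
exists (- t 0 1 0 1 + t 0 2 0 2 + t 0 3 0 3) => x y.
have l1 := curvature_like_lin1 T_like; have l2 := curvature_like_lin2 T_like.
have l3 := curvature_like_lin3 T_like; have l4 := curvature_like_lin4 T_like.
apply: (@frame_bilinear_ext tr (fun x y => (- t 0 1 0 1 + t 0 2 0 2 + t 0 3 0 3)
  * inner h x y)) => [z a p q|z a p q|z a p q|z a p q|].
- by rewrite !trE !l2; ring.
- by rewrite !trE !l3; ring.
- by rewrite innerDl innerZl; ring.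
- by rewrite innerDr innerZr; ring.
move=> [|[|[|[|//]]]] [|[|[|[|//]]]] _ _; rewrite trE he//= !t_sorted; lra.
Qed.

Let K A B := inner2 g (L A) B.

Let K_comb a b A B : K (a *: A + b *: B) (a *: A + b *: B) =
  a ^+ 2 * K A A + a * b * (K A B + K B A) + b ^+ 2 * K B B.
Proof.
rewrite /K (linear_map_comb L_linear).
rewrite !(scalar_formD (inner2_scalar_r _ _)) !(scalar_formZ (inner2_scalar_r _ _)).
have l Z X Y : inner2 g (a *: X + b *: Y) Z = a * inner2 g X Z + b * inner2 g Y Z.
  by rewrite inner2D; congr (_ + _); exact: (scalar_formZ (inner2_scalar_l g Z)).
by rewrite !l; ring.
Qed.

(** Polarization of the quadratic form K(SP,SP) - K(P,P), which vanishes on planes.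
    As (3/5, 4/5) is a rational point of the unit circle, the planes through [v]
    and [x], [v] and [y], [v] and (3x + 4y)/5 all have unit bivectors. *)
Let sec_polar v x y :
  (forall P, plane g P -> K (S P) (S P) = K P P) ->
  inner g v v = 1 -> inner g x x = 1 -> inner g y y = 1 ->
  inner g v x = 0 -> inner g x v = 0 -> inner g v y = 0 -> inner g y v = 0 ->
  inner g x y = 0 -> inner g y x = 0 ->
  K (S (wedge2 v x)) (S (wedge2 v y)) + K (S (wedge2 v y)) (S (wedge2 v x)) =
  K (wedge2 v x) (wedge2 v y) + K (wedge2 v y) (wedge2 v x).
Proof.
move=> sec_eq vv xx yy vx xv vy yv xy yx.
have p1 : plane g (wedge2 v x).
  by split; [exists v, x|rewrite inner2_wedge2 vv xx vx; ring].
have p2 : plane g (wedge2 v y).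
  by split; [exists v, y|rewrite inner2_wedge2 vv yy vy; ring].
have p3 : plane g ((3 / 5) *: wedge2 v x + (4 / 5) *: wedge2 v y).
  have e4 : (4 / 5) *: wedge2 v y = wedge2 v ((4 / 5) *: y).
    have w0 : wedge2 v 0 = 0 by rewrite /wedge2 trmx0 mulmx0 mul0mx subr0.
    by rewrite -[(4 / 5) *: y]addr0 wedge2_linear_r w0 addr0.
  rewrite e4 -wedge2_linear_r; split; first by exists v, ((3 / 5) *: x + (4 / 5) *: y).
  rewrite inner2_wedge2 !(innerDl, innerDr, innerZl, innerZr) vv xx yy vx xv vy yv xy yx.
  by field.
have := sec_eq _ p3; rewrite (linear_map_comb S_linear) !K_comb.
by rewrite (sec_eq _ p1) (sec_eq _ p2); lra.
Qed.

(** The frame planes 01, 02, 03 give the diagonal equations, and the six polarized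
    pairs of frame planes with a common vector the others. *)
Lemma sec_components :
  (forall P, plane g P -> inner2 g (L (S P)) (S P) = inner2 g (L P) P) <->
  star_invariant_components.
Proof.
split=> [sec_eq|/star_commute_components comm P [[v [x ->]] _]]; last first.
  have bP := wedge2_bivector v x.
  by rewrite comm// star_isometry//; exact: L_biv.
have diag i j : (i < j < 4)%N -> K (S (w i j)) (S (w i j)) = K (w i j) (w i j).
  move=> /andP[ij j4]; have i4 := ltn_trans ij j4; apply: sec_eq; split.
    by exists (e i), (e j).
  by rewrite inner2_frame// !eqxx (gtn_eqF ij) (ltn_eqF ij) /=; ring.
have polar i j k : (i < 4)%N -> (j < 4)%N -> (k < 4)%N -> i != j -> i != k -> j != k ->
    K (S (w i j)) (S (w i k)) + K (S (w i k)) (S (w i j)) =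
    K (w i j) (w i k) + K (w i k) (w i j).
  move=> i4 j4 k4 /negbTE ij /negbTE ik /negbTE jk.
  have [ji ki kj] : [/\ (j == i) = false, (k == i) = false & (k == j) = false].
    by rewrite !(eq_sym k) (eq_sym j).
  by apply: sec_polar => //; rewrite ge// ?eqxx// ?ij ?ik ?jk ?ji ?ki ?kj.
have := (diag 0 1 isT, diag 0 2 isT, diag 0 3 isT, polar 0 1 2 isT isT isT isT isT isT,
  polar 0 1 3 isT isT isT isT isT isT, polar 0 2 3 isT isT isT isT isT isT,
  polar 1 0 2 isT isT isT isT isT isT, polar 1 0 3 isT isT isT isT isT isT,
  polar 2 0 1 isT isT isT isT isT isT)%N.
have SN := linear_mapN S_linear.
rewrite /K (wedge2C (e 1%N) (e 0%N)) (wedge2C (e 2%N) (e 0%N)) (wedge2C (e 2%N) (e 1%N)).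
rewrite !SN !LN !star_frame !LN !inner2Nl !inner2Nr !K_frame !t_sorted.
move=> [[[[[[[[k1 k2] k3] k4] k5] k6] k7] k8] k9].
by rewrite /star_invariant_components !t_sorted; do !split; lra.
Qed.

End CurvatureConditions.
End Star.
End AdaptedFrame.

(** * Existence of the star and of adapted frames *)

Section FrameExistence.
Variable R : realType.
Implicit Types (g h m E : 'M[R]_4).

Lemma frame_bivector_span E A : E \in unitmx -> bivector A ->
  exists c : nat -> nat -> R, let w i j := c i j *:
      wedge2 (row (inord i) E) (row (inord j) E) in
    A = w 0%N 1%N + w 0%N 2%N + w 0%N 3%N + w 2%N 3%N + w 1%N 3%N + w 1%N 2%N.
Proof.
by move=> uE /(bivector_frame uE)[c ->]; exists (fun i j => c (inord i) (inord j)).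
Qed.

(** The determinant of an oriented orthonormal frame depends on [h] only, so a star
    that works for one frame works for all. *)
Lemma hodge_starP h E : Defs.orthonormal h E -> 0 < \det E ->
  is_hodge_star h (hodge_star h).
Proof.
move=> hE dE; have uE := frame_unit hE.
have [S [S_lin S_biv S_star]] := @star_exists R h (fun i => row (inord i) E) (\det E)
  (fun A => @frame_bivector_span E A uE) (wedge22_wedge2 E).
have spec : is_hodge_star h S.
  split=> // F hF dF A B bA _; rewrite S_star//; congr (_ * _).
  have hn0 : `|\det h| != 0.
    by rewrite normr_eq0 -unitfE -unitmxE; exact: frame_form_unit hE.
  have /(mulIf hn0)/eqP : `|\det E| ^+ 2 * `|\det h| = `|\det F| ^+ 2 * `|\det h|.
    by rewrite !frame_det_norm.
  by rewrite eqrXn2// !gtr0_norm// => /eqP.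
by rewrite /hodge_star; case: xgetP => [S' _ //|/(_ S)].
Qed.

(** [s] is 1 or -1, to reach either orientation. *)
Let rearrange (s : R) (f : 'I_4 -> 'I_4) E : 'M[R]_4 :=
  \matrix_(k < 4) ((if k == ord0 then s else 1) *: row (f k) E).

Let rearrange_inner m s f E a b : injective f -> s ^+ 2 = 1 -> Defs.orthonormal m E ->
  inner m (row a (rearrange s f E)) (row b (rearrange s f E)) =
  if a == b then frame_signs m E 0 (f a) else 0.
Proof.
move=> fI s1 mE; rewrite !rowK innerZl innerZr.
have [<-|ab] := eqVneq a b.
  by rewrite mxE mulrA -expr2; case: ifP => _; rewrite ?s1 ?expr1n mul1r.
by rewrite (mE (f a) (f b)).1 ?mulr0// (inj_eq fI).
Qed.

(** The law of inertia in a special case: det h > 0 leaves an even number of minus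
    signs, and neither 0 nor 4 because [h] takes both signs.  So there are two, and
    the frame can be reordered. *)
Lemma split_form_signs h E : split_form h -> Defs.orthonormal h E ->
  exists2 f : 'I_4 -> 'I_4, injective f &
    forall k, frame_signs h E 0 (f k) = if (k < 2)%N then -1 else 1.
Proof.
move=> [F uF hF] hE; set s := frame_signs h E 0.
have s1 k : s k = 1 \/ s k = -1.
  have /eqP : s k * s k = 1 by exact: frame_signs_sqr.
  by rewrite -expr2 sqrf_eq1 => /orP[] /eqP; [left|right].
have uE := frame_unit hE.
have quad v : exists c : 'rV[R]_4, inner h v v = \sum_k s k * c 0 k ^+ 2.
  have [c ->] : exists c, v = c *m E by exists (v *m invmx E); rewrite mulmxKV.
  exists c; rewrite -inner_pullback (frame_diagonal hE) /inner mxE.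
  apply: eq_bigr => k _; rewrite mul_mx_diag [X in X * _]mxE [c^T _ _]mxE.
  by rewrite -/s; ring.
have hFE k : inner h (row k F) (row k F) = if (k < 2)%N then -1 else 1.
  by rewrite -congruence_entry hF !mxE eqxx.
have prod4 (t : 'I_4 -> R) :
    \prod_k t k = t (inord 0) * t (inord 1) * t (inord 2) * t (inord 3).
  rewrite !big_ord_recl big_ord0 mulr1 !mulrA.
  by congr (t _ * t _ * t _ * t _); apply: val_inj; rewrite /= inordK.
have s_prod : 0 < s (inord 0) * s (inord 1) * s (inord 2) * s (inord 3).
  have detF : \det F ^+ 2 * \det h = 1.
    have := congr1 determinant hF; rewrite !det_mulmx det_tr det_diag prod4 !mxE.
    by rewrite !inordK//= => e; rewrite expr2 mulrAC e; ring.
  have deth : 0 < \det h.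
    by rewrite -(@pmulr_rgt0 _ (\det F ^+ 2)) ?detF// exprn_even_gt0//= -unitfE -unitmxE.
  rewrite -prod4 -(frame_det hE) mulr_gt0// exprn_even_gt0//=.
  by rewrite -unitfE -unitmxE.
have not_pos : ~ forall k, s k = 1.
  move=> pos; have [c] := quad (row (inord 0) F); rewrite hFE inordK//= => e.
  have : 0 <= \sum_k s k * c 0 k ^+ 2.
    by apply: sumr_ge0 => k _; rewrite pos mul1r sqr_ge0.
  by rewrite -e; lra.
have not_neg : ~ forall k, s k = -1.
  move=> neg; have [c] := quad (row (inord 2) F); rewrite hFE inordK//= => e.
  have : \sum_k s k * c 0 k ^+ 2 <= 0.
    by apply: sumr_le0 => k _; rewrite neg mulN1r oppr_le0 sqr_ge0.
  by rewrite -e; lra.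
have ord4 (P : 'I_4 -> Prop) : P (inord 0) -> P (inord 1) -> P (inord 2) ->
    P (inord 3) -> forall k, P k.
  move=> P0 P1 P2 P3 k; rewrite -(inord_val k).
  by case: k => [[|[|[|[|]]]]].
have order (l : seq nat) : uniq l -> size l = 4%N -> all (ltn^~ 4%N) l ->
    (forall k : 'I_4, s (inord (nth 0%N l k)) = if (k < 2)%N then -1 else 1) ->
    exists2 f : 'I_4 -> 'I_4, injective f &
      forall k, s (f k) = if (k < 2)%N then -1 else 1.
  move=> ul sl l4 sE; exists (fun k => inord (nth 0%N l k)) => // a b.
  move=> /(congr1 val)/=.
  have lt4 (k : 'I_4) : (nth 0%N l k < 4)%N by apply: (allP l4); rewrite mem_nth ?sl.
  rewrite !inordK ?lt4// => /eqP; rewrite nth_uniq ?sl// => /eqP.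
  exact: val_inj.
have [s0|s0] := s1 (inord 0); have [s1'|s1'] := s1 (inord 1);
  have [s2|s2] := s1 (inord 2); have [s3|s3] := s1 (inord 3);
  move: s_prod; rewrite s0 s1' s2 s3 ?(mulr1, mul1r, mulrN1, mulN1r, opprK);
  rewrite ?ltr0N1 // => _.
- by case: not_pos; exact: ord4.
- apply: (order [:: 2; 3; 0; 1]%N) => //; apply: ord4; rewrite inordK//=.
- apply: (order [:: 1; 3; 0; 2]%N) => //; apply: ord4; rewrite inordK//=.
- apply: (order [:: 1; 2; 0; 3]%N) => //; apply: ord4; rewrite inordK//=.
- apply: (order [:: 0; 3; 1; 2]%N) => //; apply: ord4; rewrite inordK//=.
- apply: (order [:: 0; 2; 1; 3]%N) => //; apply: ord4; rewrite inordK//=.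
- apply: (order [:: 0; 1; 2; 3]%N) => //; apply: ord4; rewrite inordK//=.
- by case: not_neg; exact: ord4.
Qed.

(** The common frame is reordered by the signs of [h], and its first vector is
    reversed if the orientation requires it. *)
Lemma adapted_frame g h E0 : positive_definite g -> split_form h ->
  Defs.orthonormal g E0 -> Defs.orthonormal h E0 ->
  exists E, [/\ 0 < \det E,
    forall a b, inner g (row a E) (row b E) = (a == b)%:R &
    forall a b, inner h (row a E) (row b E) =
      if a == b then (if (a < 2)%N then -1 else 1) else 0].
Proof.
move=> gpos hsplit gE hE.
have [f fI fE] := split_form_signs hsplit hE.
have g1 k : frame_signs g E0 0 k = 1.
  have := frame_signs_norm gE k; rewrite ger0_norm// mxE.
  have [->|/gpos/ltW//] := eqVneq (row k E0) 0.
  by rewrite inner0l.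
have frame s : s ^+ 2 = 1 -> [/\
    forall a b, inner g (row a (rearrange s f E0)) (row b (rearrange s f E0)) = (a == b)%:R
    & forall a b, inner h (row a (rearrange s f E0)) (row b (rearrange s f E0)) =
      if a == b then (if (a < 2)%N then -1 else 1) else 0].
  move=> s1; split=> a b; rewrite rearrange_inner//.
    by rewrite g1; case: eqP.
  by rewrite fE.
have d0 : \det (rearrange 1 f E0) != 0.
  rewrite -unitfE -unitmxE; apply: (@frame_unit _ g) => a b.
  have [-> _] := frame 1 (expr1n _ _); split=> [/negbTE->//|].
  by have [-> _] := frame 1 (expr1n _ _); rewrite eqxx normr1.
have dN : \det (rearrange (-1) f E0) = - \det (rearrange 1 f E0).
  have -> : rearrange (-1) f E0 =
      diag_mx (\row_k (if k == ord0 then -1 else 1)) *m rearrange 1 f E0.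
    apply/matrixP => i j; rewrite mul_diag_mx !mxE.
    by case: ifP => _; rewrite !mul1r.
  by rewrite det_mulmx det_diag big_ord_recl big1 ?mxE ?mulr1 ?mulN1r// => k _; rewrite mxE.
have [dpos|dneg|/eqP] := ltrgtP 0 (\det (rearrange 1 f E0)); last by rewrite eq_sym (negbTE d0).
  by have [] := frame 1 (expr1n _ _); exists (rearrange 1 f E0).
have m1 : (-1) ^+ 2 = 1 :> R by rewrite sqrrN expr1n.
have [] := frame (-1) m1; exists (rearrange (-1) f E0); split=> //.
by rewrite dN oppr_gt0.
Qed.

End FrameExistence.

Section PointwiseEquivalence.
Variables (R : realType) (g h E0 : 'M[R]_4) (T : tensor4 R).
Hypotheses (gsym : g^T = g) (gpos : positive_definite g) (hsplit : split_form h).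
Hypotheses (gE0 : Defs.orthonormal g E0) (hE0 : Defs.orthonormal h E0).
Hypothesis T_like : curvature_like T.
Local Notation L := (curvature_operator g T).
Local Notation S := (hodge_star h).

Lemma star_commute_pointwise :
  ((forall A, bivector A -> L (S A) = S (L A)) <->
   exists f, forall x y, trace14 h T x y = f * inner h x y) /\
  ((forall A, bivector A -> L (S A) = S (L A)) <->
   forall P, plane g P -> sec g T (S P) = sec g T P).
Proof.
have [E [dE gE hE]] := adapted_frame gpos hsplit gE0 hE0.
have hE' : Defs.orthonormal h E.
  move=> a b; split=> [/negbTE ab|]; rewrite hE ?ab// eqxx.
  by case: ifP; rewrite ?normrN normr1.
have uE := frame_unit hE'.
pose e i := row (inord i) E.
have inordE i j : (i < 4)%N -> (j < 4)%N -> (inord i == inord j :> 'I_4) = (i == j).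
  by move=> i4 j4; rewrite -val_eqE /= !inordK.
have ge i j : (i < 4)%N -> (j < 4)%N -> inner g (e i) (e j) = (i == j)%:R.
  by move=> i4 j4; rewrite gE inordE.
have he i j : (i < 4)%N -> (j < 4)%N ->
    inner h (e i) (e j) = if i == j then (if (i < 2)%N then -1 else 1) else 0.
  by move=> i4 j4; rewrite hE inordE// inordK.
have span x : exists c : nat -> R,
    x = c 0%N *: e 0%N + c 1%N *: e 1%N + c 2%N *: e 2%N + c 3%N *: e 3%N.
  exists (fun i => (x *m invmx E) 0 (inord i)).
  by rewrite -{1}[x](mulmxKV uE) mulmx_sum_row big_ord4.
have bspan A : bivector A -> _ := @frame_bivector_span _ E A uE.
have d0 : \det E != 0 by rewrite gt_eqF.
have vol : wedge22 (wedge2 (e 0%N) (e 1%N)) (wedge2 (e 2%N) (e 3%N)) = \det E.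
  exact: wedge22_wedge2.
have [S_lin S_biv S_star] := hodge_starP hE' dE.
have {}S_star A B : bivector A -> bivector B -> wedge22 A (S B) = inner2 h A B * \det E.
  exact: S_star.
have gu := frame_form_unit gE0.
have [L_lin L_biv L_curv] := curvature_operatorP gsym gu T_like.
have comm := star_commute_components ge he bspan d0 vol S_lin S_biv S_star
  T_like L_lin L_biv L_curv.
have trE x y : trace14 h T x y =
    - T (e 0%N) x y (e 0%N) - T (e 1%N) x y (e 1%N)
    + T (e 2%N) x y (e 2%N) + T (e 3%N) x y (e 3%N).
  rewrite (trace14_frame _ _ hE' T_like) big_ord4 !hE !eqxx !inordK//=.
  by rewrite !mulN1r !mul1r.
split; apply: (iff_trans comm); apply: iff_sym.
  exact: (trace_components he span T_like trE).
exact: (sec_components ge he bspan d0 vol S_lin S_biv S_star T_like L_lin L_biv L_curv).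
Qed.

End PointwiseEquivalence.

(** * Charts *)

Section Charts.
Variables (R : realType) (M : oriented4Manifold R).
Implicit Types (g h : sym2Field M) (i j : atlas_index M) (p : M).

Let chart_image i := cmap (atlas i) @` cdom (atlas i).
Let overlap i j := cmap (atlas i) @` (cdom (atlas i) `&` cdom (atlas j)).

Lemma cinv_cmap i p : cdom (atlas i) p -> cinv (atlas i) (cmap (atlas i) p) = p.
Proof. by move=> ip; apply: cmapK; rewrite inE. Qed.

Lemma open_chart_image i : open (chart_image i).
Proof. exact: cimg_open. Qed.

Lemma open_overlap i j : open (overlap i j).
Proof.
rewrite openE => _ [p [ip jp] <-].
have Ux : chart_image i (cmap (atlas i) p) by exists p.
have cont : {for cmap (atlas i) p, continuous (cinv (atlas i))}.
  have := @cinv_continuous _ _ (atlas i).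
  by rewrite (continuous_open_subspace _ (@open_chart_image i)) => /(_ _ (mem_set Ux)).
have nj : nbhs (cinv (atlas i) (cmap (atlas i) p)) (cdom (atlas j)).
  by rewrite cinv_cmap//; apply: open_nbhs_nbhs; split=> //; exact: cdom_open.
have nU : nbhs (cmap (atlas i) p) (chart_image i).
  by apply: open_nbhs_nbhs; split=> //; exact: open_chart_image.
have nV : nbhs (cmap (atlas i) p) (cinv (atlas i) @^-1` cdom (atlas j)) := cont _ nj.
suff : nbhs (cmap (atlas i) p) (overlap i j) by [].
apply: filterS (filterI nV nU) => y [jq [q iq yE]]; exists q => //; split=> //.
by move: jq; rewrite -yE /= cinv_cmap.
Qed.

Lemma smooth_gram g i : smooth_mx (chart_image i) (g i).
Proof. by move=> a b; exact: gram_smooth. Qed.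

Lemma gram_symmetric g i x : chart_image i x -> (g i x)^T = g i x.
Proof. by move=> [p ip <-]; exact: gram_sym. Qed.

Lemma riemannian_unit g i x : riemannian g -> chart_image i x -> g i x \in unitmx.
Proof.
move=> gpos [p ip <-]; have {}gpos := gpos i p ip.
rewrite -row_free_unit -kermx_eq0; apply/eqP/row_matrixP => a; rewrite row0.
apply/eqP; apply: contraT => v0; have := gpos _ v0.
by rewrite /inner -row_mul mulmx_ker row0 mul0mx mxE ltxx.
Qed.

Lemma curvature_like_Rm g i p : riemannian g -> cdom (atlas i) p ->
  curvature_like (Rm_at g i p).
Proof.
move=> gpos ip.
rewrite /Rm_at; apply: (@riemann_curvature_like _ _ (chart_image i)).
- exact: open_chart_image.
- exact: smooth_gram.
- by move=> x; exact: gram_symmetric.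
- by move=> x; exact: riemannian_unit.
- by exists p.
Qed.

Section Transition.
Variables (i j : atlas_index M).
Let J p := jacobian (transition (atlas i) (atlas j)) (cmap (atlas i) p).

Lemma transition_unit p : cdom (atlas i) p -> cdom (atlas j) p -> J p \in unitmx.
Proof.
by move=> ip jp; rewrite unitmxE unitfE gt_eqF//; exact: transition_oriented.
Qed.

Lemma gram_transition h p v w : cdom (atlas i) p -> cdom (atlas j) p ->
  inner (gram_at h i p) v w = inner (gram_at h j p) (v *m J p) (w *m J p).
Proof.
by move=> ip jp; rewrite /gram_at (gram_change h ip jp) inner_pullback.
Qed.

(** Independence of the chart, as seen by the transition maps. *)
Lemma Rm_transition g p u v w z : riemannian g ->
  cdom (atlas i) p -> cdom (atlas j) p ->
  Rm_at g i p u v w z = Rm_at g j p (u *m J p) (v *m J p) (w *m J p) (z *m J p).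
Proof.
move=> gpos ip jp; rewrite /Rm_at /J.
have sub x : overlap i j x -> chart_image i x by move=> [q [iq _] <-]; exists q.
have phiE q : cdom (atlas i) q ->
    transition (atlas i) (atlas j) (cmap (atlas i) q) = cmap (atlas j) q.
  by move=> iq; rewrite /transition /= cinv_cmap.
rewrite -[in RHS](phiE _ ip).
apply: (@riemann_pushforward R (overlap i j) (chart_image j)).
- exact: open_overlap.
- exact: open_chart_image.
- by move=> a b; rewrite (ord1 a); exact: transition_smooth.
- by move=> _ [q [iq jq] <-]; rewrite phiE//; exists q.
- by move=> a b vs x /sub; exact: smooth_gram.
- exact: smooth_gram.
- by move=> x /sub; exact: gram_symmetric.
- by move=> x; exact: gram_symmetric.
- by move=> x /sub; exact: riemannian_unit.
- by move=> x; exact: riemannian_unit.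
- by move=> _ [q [iq jq] <-]; exact: transition_unit.
- by move=> _ [q [iq jq] <-]; rewrite phiE//; exact: gram_change.
by exists p.
Qed.

Lemma orthonormal_transition h p E : cdom (atlas i) p -> cdom (atlas j) p ->
  Defs.orthonormal (gram_at h i p) E -> Defs.orthonormal (gram_at h j p) (E *m J p).
Proof. by move=> ip jp hE a b; rewrite !row_mul -!gram_transition//; exact: hE. Qed.

Lemma tr_Rm_transition g h p E x y : riemannian g ->
  cdom (atlas i) p -> cdom (atlas j) p -> Defs.orthonormal (gram_at h i p) E ->
  tr_Rm h g i p x y = tr_Rm h g j p (x *m J p) (y *m J p).
Proof.
move=> gpos ip jp hE.
rewrite /tr_Rm (trace14_frame _ _ hE (curvature_like_Rm gpos ip)).
rewrite (trace14_frame _ _ (orthonormal_transition ip jp hE) (curvature_like_Rm gpos jp)).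
apply: eq_bigr => k _.
by rewrite Rm_transition// !row_mul -gram_transition.
Qed.

End Transition.

(** The hypothesis provides a frame in one chart at [p]; Jacobians carry it to all
    others. *)
Lemma common_frame g h i p : deformation g h -> cdom (atlas i) p ->
  exists E, Defs.orthonormal (gram_at g i p) E /\ Defs.orthonormal (gram_at h i p) E.
Proof.
move=> gh ip; have [j [U [E [_ Up Uj _ /(_ _ Up)[gE hE]]]]] := gh p.
have jp := Uj _ Up.
eexists; split; first exact: orthonormal_transition gE.
exact: orthonormal_transition hE.
Qed.

(** The equation contracted with the inverse of [h] is 4 f = tr(h^-1 Ric), where
    Ric is the trace of the curvature with respect to [h]. *)
Lemma trace_factor_smooth g h (f : M -> R) : riemannian g -> deformation g h ->
  (forall i p, cdom (atlas i) p -> forall x y,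
     tr_Rm h g i p x y = f p * inner (gram_at h i p) x y) ->
  smooth_function f.
Proof.
move=> gpos gh fE i.
have Uopen := @open_chart_image i.
have gsm := smooth_gram g (i := i); have hsm := smooth_gram h (i := i).
pose ric x a b := \tr (invmx (h i x) *m \matrix_(c, d) riemann (g i) x
  (delta_mx 0 c) (delta_mx 0 a) (delta_mx 0 b) (delta_mx 0 d)).
have hu x : (cmap (atlas i) @` cdom (atlas i)) x -> h i x \in unitmx.
  by move=> [p ip <-]; have [E [_ /frame_form_unit]] := common_frame gh ip.
have hinv : smooth_mx (cmap (atlas i) @` cdom (atlas i)) (fun x => invmx (h i x)).
  exact: smooth_mx_inv.
have sric a b : smooth_on (cmap (atlas i) @` cdom (atlas i)) (fun x => ric x a b).
  apply: smooth_on_sum => // c; apply: (smooth_mxM Uopen hinv) => {}c d.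
  apply: smooth_on_ext (smooth_riemann Uopen gsm _ _ (delta_mx 0 c) (delta_mx 0 a)
    (delta_mx 0 b) (delta_mx 0 d)) => // [x _|x|x]; first by rewrite mxE.
    exact: gram_symmetric.
  exact: riemannian_unit.
apply: (@smooth_on_ext _ _ Uopen (fun x => 4^-1 * \sum_a \sum_b invmx (h i x) a b * ric x b a)).
  move=> _ [p ip <-]; rewrite /= cinv_cmap//.
  have ricE a b : ric (cmap (atlas i) p) a b = f p * h i (cmap (atlas i) p) a b.
    have [E [_ hE]] := common_frame gh ip.
    rewrite -inner_delta -(fE i p ip) /tr_Rm.
    by rewrite (trace14E _ _ hE (curvature_like_Rm gpos ip)).
  have -> : \sum_a \sum_b invmx (h i (cmap (atlas i) p)) a b * ric (cmap (atlas i) p) b a =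
      f p * \tr (invmx (h i (cmap (atlas i) p)) *m h i (cmap (atlas i) p)).
    rewrite big_distrr; apply: eq_bigr => a _; rewrite mxE big_distrr.
    by apply: eq_bigr => b _; rewrite ricE /= mulrCA.
  rewrite mulVmx ?mxtrace1; last by apply: hu; exists p.
  by field.
apply: smooth_onM => //; first exact: smooth_on_cst.
apply: smooth_on_sum => // a; apply: smooth_on_sum => // b.
by apply: smooth_onM => //; exact: hinv.
Qed.

End Charts.

Theorem theorem6 (R : realType) (M : oriented4Manifold R) (g h : sym2Field M)
    (g_riemannian : riemannian g) (h_split : split_signature h)
    (gh : deformation g h) :
  (star_einstein g h <->
   exists f : M -> R, smooth_function f /\
     forall (i : atlas_index M) (p : M), cdom (atlas i) p ->
     forall x y : 'rV[R]_4,
       tr_Rm h g i p x y = f p * inner (gram_at h i p) x y) /\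
  (star_einstein g h <->
   forall (i : atlas_index M) (p : M), cdom (atlas i) p ->
   forall P : 'M[R]_4, is_plane g i p P ->
     sec_at g i p (star h i p P) = sec_at g i p P).
Proof.
have pointwise i p : cdom (atlas i) p -> _ := fun ip =>
  let: ex_intro E (conj gE hE) := common_frame gh ip in
  star_commute_pointwise (gram_sym g ip) (g_riemannian i p ip) (h_split i p ip)
    gE hE (curvature_like_Rm g_riemannian ip).
split; last first.
  split=> [SE i p ip|secE i p ip]; first by apply/(pointwise i p ip).2; exact: SE.
  by apply/(pointwise i p ip).2; exact: secE.
split=> [SE|[f [_ trE]] i p ip]; last first.
  by apply/(pointwise i p ip).1; exists (f p); exact: trE.
(* The factor found in one chart at p serves in all of them. *)
have : forall p, exists c, forall i, cdom (atlas i) p -> forall x y,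
    tr_Rm h g i p x y = c * inner (gram_at h i p) x y.
  move=> p; have [i ip] := atlas_cover p.
  have [c cE] := (pointwise i p ip).1.1 (SE i p ip).
  exists c => j jp x y; have [E [_ hE]] := common_frame gh jp.
  rewrite (tr_Rm_transition x y g_riemannian jp ip hE).
  by rewrite (gram_transition h x y jp ip); exact: cE.
move=> /choice[f fE].
have {}fE i p : cdom (atlas i) p -> forall x y,
    tr_Rm h g i p x y = f p * inner (gram_at h i p) x y by exact: fE.
by exists f; split; [exact: trace_factor_smooth fE|exact: fE].
Qed.
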